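(* Let $\bar M^{2n+1}(f_1,f_2,f_3)$, $n>1$, be a generalized Sasakian-space-form with structure $(\phi,\xi,\eta,g)$ and Levi-Civita connection $\bar\nabla$ satisfying the standing identities for $\bar\nabla\phi$ and $\bar\nabla\xi$ listed in the context, and let $\bar\nabla'$ be the semisymmetric non-metric connection $\bar\nabla'_XY=\bar\nabla_XY+\eta(Y)X$. Let $M$ be an $(m+1)$-dimensional almost semi-invariant submanifold of $\bar M^{2n+1}(f_1,f_2,f_3)$ which is minimal with respect to $\bar\nabla'$, i.e. $H'=0$. Then: (i) for every vector field $X$ tangent to $M$, $$S'(X,X)\le\sum_{\lambda}(mf_1+3f_2\lambda^2-f_3+1)\,g(U^\lambda X,U^\lambda X)+m(f_1-f_3)\,\eta(X)\eta(X)+(f_1-f_3)\,g(TX,X);$$ (ii) $$\tau'\le f_1+\frac{1}{m(m+1)}\Big\{3f_2\sum_{\lambda}n(\lambda)\lambda^2-2mf_3+m\Big\}.$$ Here $S'$ and $\tau'$ are the Ricci tensor and the (normalized) scalar curvature of the connection $\nabla'$ induced on $M$ by $\bar\nabla'$, and $\lambda$ runs over $\{1,0,\lambda_1,\dots,\lambda_l\}$.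
   Context: **Ambient space.** An almost contact metric manifold $\bar M(\phi,\xi,\eta,g)$ satisfies $\phi^2X=-X+\eta(X)\xi$, $\phi\xi=0$, $\eta(\xi)=1$, $g(X,\xi)=\eta(X)$, $\eta(\phi X)=0$, $g(\phi X,\phi Y)=g(X,Y)-\eta(X)\eta(Y)$, $g(\phi X,Y)=-g(X,\phi Y)$. The curvature of a connection $D$ is $R(X,Y)Z=D_XD_YZ-D_YD_XZ-D_{[X,Y]}Z$. A generalized Sasakian-space-form $\bar M^{2n+1}(f_1,f_2,f_3)$ is an almost contact metric manifold of dimension $2n+1$ (with $n>1$) together with smooth functions $f_1,f_2,f_3$ such that the curvature of the Levi-Civita connection $\bar\nabla$ is $$\bar R(X,Y)Z=f_1\{g(Y,Z)X-g(X,Z)Y\}+f_2\{g(X,\phi Z)\phi Y-g(Y,\phi Z)\phi X+2g(X,\phi Y)\phi Z\}+f_3\{\eta(X)\eta(Z)Y-\eta(Y)\eta(Z)X+g(X,Z)\eta(Y)\xi-g(Y,Z)\eta(X)\xi\}.$$ Standing identities, used throughout for $\bar M^{2n+1}(f_1,f_2,f_3)$: $$(\bar\nabla_X\phi)(Y)=(f_1-f_3)[g(X,Y)\xi-\eta(Y)X],\qquad \bar\nabla_X\xi=-(f_1-f_3)\phi X.$$ **Submanifold.** $M$ is a submanifold of dimension $m+1$ ($m\ge 1$) with $\xi$ tangent to $M$ and the induced metric $g$. For $X$ tangent to $M$ write $\phi X=TX+FX$ with $TX$ tangent and $FX$ normal. Let $D$ be the orthogonal complement of $\xi$ in $TM$.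 $M$ is almost semi-invariant if there exist $l$ functions $\lambda_1,\dots,\lambda_l$ on $M$ with values in $(0,1)$ such that (a) at each $p\in M$, $-\lambda_1^2(p),\dots,-\lambda_l^2(p)$ are distinct eigenvalues of $T^2|_D$ and $T_pM=D^1_p\oplus D^0_p\oplus D^{\lambda_1}_p\oplus\cdots\oplus D^{\lambda_l}_p\oplus\mathrm{span}\{\xi_p\}$, where $D^\lambda_p$, $\lambda\in\{1,0,\lambda_1(p),\dots,\lambda_l(p)\}$, is the eigenspace of $T^2|_D$ for the eigenvalue $-\lambda^2$; (b) the dimensions of $D^1_p,D^0_p,D^{\lambda_1}_p,\dots,D^{\lambda_l}_p$ do not depend on $p$. $U^\lambda$ is the orthogonal projection $TM\to D^\lambda$ and $n(\lambda)=\dim D^\lambda$. Sums $\sum_\lambda$ run over $\lambda\in\{1,0,\lambda_1,\dots,\lambda_l\}$. **Induced objects.** For $X,Y$ tangent to $M$, $\bar\nabla'_XY=\nabla'_XY+h'(X,Y)$ is the decomposition into tangential and normal parts; $\nabla'$ is the induced connection and $h'$ the second fundamental form with respect to it. Let $R'$ be the curvature of $\nabla'$ and $R'(X,Y,Z,W)=g(R'(X,Y)Z,W)$. For a local orthonormal frame $\{E_1,\dots,E_{m+1}\}$ of $TM$ with $E_{m+1}=\xi$: $H'=\frac1{m+1}\sum_ih'(E_i,E_i)$, $S'(X,Y)=\sum_{i=1}^{m+1}R'(X,E_i,E_i,Y)$, and $\tau'=\frac{1}{m(m+1)}\sum_{i,j=1}^{m+1}R'(E_i,E_j,E_j,E_i)$.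 *)

(* Defs.v *)
From HB Require Import structures.
From mathcomp Require Import all_boot all_order all_algebra.
From mathcomp Require Import all_classical all_reals all_analysis.

Set Implicit Arguments.
Unset Strict Implicit.
Unset Printing Implicit Defensive.

Import Order.TTheory GRing.Theory Num.Theory.
Import numFieldNormedType.Exports.
Local Open Scope classical_set_scope.
Local Open Scope ring_scope.

Fixpoint Ck {R : realType} {V W : normedModType R} (k : nat) (U : set V)
    (f : V -> W) : Prop :=
  match k with
  | 0 => forall x, U x -> {for x, continuous f}
  | k'.+1 => (forall x, U x -> differentiable f x)
             /\ forall v, Ck k' U ('D_v f)
  end.

(* Meant for open U, like every notion below that mentions a set U. *)
Definition smooth_on {R : realType} {V W : normedModType R} (U : set V)
  (f : V -> W) : Prop := forall k, Ck k U f.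

(* The atlas is given as a family with one chart around each point. The
   preferred chart at p identifies the tangent space T_p M with 'rV_N: the row
   vector v stands for the tangent vector with coordinates v in [chart p]. *)
Record manifold (R : realType) (N : nat) := Manifold {
  carrier :> topologicalType;
  chart : carrier -> carrier -> 'rV[R]_N;
  dom : carrier -> set carrier;
  chart_inv : carrier -> 'rV[R]_N -> carrier;
  manifold_hausdorff : hausdorff_space carrier;
  manifold_second_countable : @second_countable carrier;
  dom_open : forall p, open (dom p);
  dom_center : forall p, dom p p;
  chartK : forall p q, dom p q -> chart_inv p (chart p q) = q;
  chart_open : forall p, open (chart p @` dom p);
  chart_continuous : forall p q, dom p q -> {for q, continuous (chart p)};
  chart_inv_continuous : forall p x, (chart p @` dom p) x ->
    {for x, continuous (chart_inv p)};
  chart_smooth : forall p q,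
    smooth_on (chart p @` (dom p `&` dom q)) (chart q \o chart_inv p)
}.

Definition vfield {R : realType} {N : nat} (M : manifold R N) : Type :=
  M -> 'rV[R]_N.

(* The derivative v(f) of f along the tangent vector v at p. *)
Definition dfun {R : realType} {N : nat} {M : manifold R N}
    {W : normedModType R} (f : M -> W) (p : M) (v : 'rV[R]_N) : W :=
  'D_v (f \o chart_inv p) (chart p p).

Definition smooth_fun {R : realType} {N : nat} {M : manifold R N}
    {W : normedModType R} (U : set M) (f : M -> W) : Prop :=
  forall p, smooth_on (chart p @` (dom p `&` U)) (f \o chart_inv p).

(* Components of X in the fixed chart at b; meaningful on [dom b]. *)
Definition comps {R : realType} {N : nat} {M : manifold R N} (b : M)
    (X : vfield M) : M -> 'rV[R]_N :=
  fun q => dfun (chart b) q (X q).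

Definition smooth_vf {R : realType} {N : nat} {M : manifold R N} (U : set M)
    (X : vfield M) : Prop :=
  forall b, smooth_fun (U `&` dom b) (comps b X).

(* The field on [dom b] with constant components v in the chart at b. *)
Definition const_field {R : realType} {N : nat} {M : manifold R N} (b : M)
    (v : 'rV[R]_N) : vfield M :=
  fun x => 'D_v (chart x \o chart_inv b) (chart b x).

(* [X,Y]^k = X(Y(x^k)) - Y(X(x^k)) for the coordinates x^k of the chart at p. *)
Definition lie {R : realType} {N : nat} {M : manifold R N} (X Y : vfield M) :
    vfield M :=
  fun p => dfun (comps p Y) p (X p) - dfun (comps p X) p (Y p).

(* Connections act on fields defined on all of M but possibly smooth only on
   an open set U; the axioms express a connection on the sheaf of smooth
   fields, and values at points where the fields are not smooth are junk. *)
Record is_connection {R : realType} {N : nat} (M : manifold R N)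
    (nab : vfield M -> vfield M -> vfield M) : Prop := {
  conn_smooth : forall U X Y, open U -> smooth_vf U X -> smooth_vf U Y ->
    smooth_vf U (nab X Y);
  conn_local : forall U X X' Y Y', open U ->
    smooth_vf U X -> smooth_vf U Y ->
    (forall q, U q -> X q = X' q) -> (forall q, U q -> Y q = Y' q) ->
    forall p, U p -> nab X Y p = nab X' Y' p;
  conn_addl : forall U X X' Y, open U ->
    smooth_vf U X -> smooth_vf U X' -> smooth_vf U Y ->
    forall p, U p -> nab (fun q => X q + X' q) Y p = nab X Y p + nab X' Y p;
  conn_scalel : forall U (f : M -> R) X Y, open U ->
    smooth_fun U f -> smooth_vf U X -> smooth_vf U Y ->
    forall p, U p -> nab (fun q => f q *: X q) Y p = f p *: nab X Y p;
  conn_addr : forall U X Y Y', open U ->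
    smooth_vf U X -> smooth_vf U Y -> smooth_vf U Y' ->
    forall p, U p -> nab X (fun q => Y q + Y' q) p = nab X Y p + nab X Y' p;
  conn_leibniz : forall U (f : M -> R) X Y, open U ->
    smooth_fun U f -> smooth_vf U X -> smooth_vf U Y ->
    forall p, U p ->
      nab X (fun q => f q *: Y q) p = dfun f p (X p) *: Y p + f p *: nab X Y p
}.

Definition curv {R : realType} {N : nat} {M : manifold R N}
    (nab : vfield M -> vfield M -> vfield M) (X Y Z : vfield M) : vfield M :=
  fun p => nab X (nab Y Z) p - nab Y (nab X Z) p - nab (lie X Y) Z p.

Record is_metric {R : realType} {N : nat} (M : manifold R N)
    (g : M -> 'rV[R]_N -> 'rV[R]_N -> R) : Prop := {
  metric_linear : forall p a u v w,
    g p (a *: u + v) w = a * g p u w + g p v w;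
  metric_sym : forall p u v, g p u v = g p v u;
  metric_pos : forall p v, v != 0 -> 0 < g p v v;
  metric_smooth : forall U X Y, open U -> smooth_vf U X -> smooth_vf U Y ->
    smooth_fun U (fun q => g q (X q) (Y q))
}.

Record is_levi_civita {R : realType} {N : nat} (M : manifold R N)
    (g : M -> 'rV[R]_N -> 'rV[R]_N -> R)
    (nab : vfield M -> vfield M -> vfield M) : Prop := {
  lc_connection : is_connection nab;
  lc_torsion_free : forall U X Y, open U -> smooth_vf U X -> smooth_vf U Y ->
    forall p, U p -> nab X Y p - nab Y X p = lie X Y p;
  lc_metric : forall U X Y Z, open U ->
    smooth_vf U X -> smooth_vf U Y -> smooth_vf U Z ->
    forall p, U p ->
      dfun (fun q => g q (Y q) (Z q)) p (X p)
      = g p (nab X Y p) (Z p) + g p (Y p) (nab X Z p)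
}.

Record almost_contact_metric {R : realType} {N : nat} (M : manifold R N)
    (phi : M -> 'rV[R]_N -> 'rV[R]_N) (xi : vfield M)
    (eta : M -> 'rV[R]_N -> R) (g : M -> 'rV[R]_N -> 'rV[R]_N -> R) : Prop := {
  acm_metric : is_metric g;
  acm_phi_linear : forall p, linear (phi p);
  acm_phi_smooth : forall U X, open U -> smooth_vf U X ->
    smooth_vf U (fun q => phi q (X q));
  acm_xi_smooth : smooth_vf setT xi;
  acm_phi2 : forall p v, phi p (phi p v) = - v + eta p v *: xi p;
  acm_phi_xi : forall p, phi p (xi p) = 0;
  acm_eta_xi : forall p, eta p (xi p) = 1;
  acm_g_xi : forall p v, g p v (xi p) = eta p v;
  acm_eta_phi : forall p v, eta p (phi p v) = 0;
  acm_g_phi : forall p u v,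
    g p (phi p u) (phi p v) = g p u v - eta p u * eta p v;
  acm_phi_skew : forall p u v, g p (phi p u) v = - g p u (phi p v)
}.

Definition gssf_curvature {R : realType} {N : nat} {M : manifold R N}
    (phi : M -> 'rV[R]_N -> 'rV[R]_N) (xi : vfield M)
    (eta : M -> 'rV[R]_N -> R) (g : M -> 'rV[R]_N -> 'rV[R]_N -> R)
    (f1 f2 f3 : M -> R) (p : M) (x y z : 'rV[R]_N) : 'rV[R]_N :=
  f1 p *: (g p y z *: x - g p x z *: y)
  + f2 p *: (g p x (phi p z) *: phi p y - g p y (phi p z) *: phi p x
             + (2 * g p x (phi p y)) *: phi p z)
  + f3 p *: ((eta p x * eta p z) *: y - (eta p y * eta p z) *: x
             + (g p x z * eta p y) *: xi p - (g p y z * eta p x) *: xi p).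

(* [gssf_nabla_phi] and [gssf_nabla_xi] are standing assumptions, not
   consequences of the curvature formula. *)
Record gen_sasakian_space_form {R : realType} {n : nat}
    (M : manifold R n.*2.+1)
    (phi : M -> 'rV[R]_n.*2.+1 -> 'rV[R]_n.*2.+1) (xi : vfield M)
    (eta : M -> 'rV[R]_n.*2.+1 -> R)
    (g : M -> 'rV[R]_n.*2.+1 -> 'rV[R]_n.*2.+1 -> R)
    (f1 f2 f3 : M -> R) (nab : vfield M -> vfield M -> vfield M) : Prop := {
  gssf_acm : almost_contact_metric phi xi eta g;
  gssf_lc : is_levi_civita g nab;
  gssf_f1 : smooth_fun setT f1;
  gssf_f2 : smooth_fun setT f2;
  gssf_f3 : smooth_fun setT f3;
  gssf_curv : forall U X Y Z, open U ->
    smooth_vf U X -> smooth_vf U Y -> smooth_vf U Z ->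
    forall p, U p ->
      curv nab X Y Z p = gssf_curvature phi xi eta g f1 f2 f3 p (X p) (Y p) (Z p);
  gssf_nabla_phi : forall U X Y, open U -> smooth_vf U X -> smooth_vf U Y ->
    forall p, U p ->
      nab X (fun q => phi q (Y q)) p - phi p (nab X Y p)
      = (f1 p - f3 p) *: (g p (X p) (Y p) *: xi p - eta p (Y p) *: X p);
  gssf_nabla_xi : forall U X, open U -> smooth_vf U X ->
    forall p, U p -> nab X xi p = - (f1 p - f3 p) *: phi p (X p)
}.

Definition semisym {R : realType} {N : nat} {M : manifold R N}
    (eta : M -> 'rV[R]_N -> R) (nab : vfield M -> vfield M -> vfield M) :
    vfield M -> vfield M -> vfield M :=
  fun X Y p => nab X Y p + eta p (Y p) *: X p.

Definition dmap {R : realType} {N k : nat} {B : manifold R N}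
    {M : manifold R k} (iota : M -> B) (p : M) (v : 'rV[R]_k) : 'rV[R]_N :=
  dfun (chart (iota p) \o iota) p v.

Record is_submanifold {R : realType} {N k : nat} (B : manifold R N)
    (M : manifold R k) (iota : M -> B) : Prop := {
  submfd_inj : injective iota;
  submfd_continuous : continuous iota;
  submfd_smooth : forall b, smooth_fun (iota @^-1` dom b) (chart b \o iota);
  submfd_immersion : forall p, injective (dmap iota p)
}.

Definition ind_metric {R : realType} {N k : nat} {B : manifold R N}
    {M : manifold R k} (g : B -> 'rV[R]_N -> 'rV[R]_N -> R) (iota : M -> B) :
    M -> 'rV[R]_k -> 'rV[R]_k -> R :=
  fun p u v => g (iota p) (dmap iota p u) (dmap iota p v).

(* The v in T_p M such that w - d iota(v) is normal to M; it exists and is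
   unique when iota is an immersion and g a metric. *)
Definition tan_part {R : realType} {N k : nat} {B : manifold R N}
    {M : manifold R k} (g : B -> 'rV[R]_N -> 'rV[R]_N -> R) (iota : M -> B)
    (p : M) (w : 'rV[R]_N) : 'rV[R]_k :=
  xget 0 [set v | forall u, g (iota p) (w - dmap iota p v) (dmap iota p u) = 0].

Definition nor_part {R : realType} {N k : nat} {B : manifold R N}
    {M : manifold R k} (g : B -> 'rV[R]_N -> 'rV[R]_N -> R) (iota : M -> B)
    (p : M) (w : 'rV[R]_N) : 'rV[R]_N :=
  w - dmap iota p (tan_part g iota p w).

(* Covariant derivative, along X tangent to M, of a field V of vectors of B
   along iota. In the chart at b = iota p, with coordinate fields d_j and
   X, V of components X^i, V^j there, it is
     X(V^j) d_j + X^i V^j nab_{d_i} d_j,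
   so it agrees with nab applied to local extensions of X and V to B. *)
Definition cov_along {R : realType} {N k : nat} {B : manifold R N}
    {M : manifold R k} (nab : vfield B -> vfield B -> vfield B)
    (iota : M -> B) (X : vfield M) (V : M -> 'rV[R]_N) (p : M) : 'rV[R]_N :=
  dfun (fun q => dfun (chart (iota p)) (iota q) (V q)) p (X p)
  + nab (const_field (iota p) (dmap iota p (X p)))
        (const_field (iota p) (V p)) (iota p).

Definition ind_conn {R : realType} {N k : nat} {B : manifold R N}
    {M : manifold R k} (g : B -> 'rV[R]_N -> 'rV[R]_N -> R)
    (nab : vfield B -> vfield B -> vfield B) (iota : M -> B) :
    vfield M -> vfield M -> vfield M :=
  fun X Y p =>
    tan_part g iota p (cov_along nab iota X (fun q => dmap iota q (Y q)) p).

Definition second_ff {R : realType} {N k : nat} {B : manifold R N}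
    {M : manifold R k} (g : B -> 'rV[R]_N -> 'rV[R]_N -> R)
    (nab : vfield B -> vfield B -> vfield B) (iota : M -> B)
    (X Y : vfield M) (p : M) : 'rV[R]_N :=
  nor_part g iota p (cov_along nab iota X (fun q => dmap iota q (Y q)) p).

Definition Tmap {R : realType} {N k : nat} {B : manifold R N}
    {M : manifold R k} (phi : B -> 'rV[R]_N -> 'rV[R]_N)
    (g : B -> 'rV[R]_N -> 'rV[R]_N -> R) (iota : M -> B)
    (p : M) (v : 'rV[R]_k) : 'rV[R]_k :=
  tan_part g iota p (phi (iota p) (dmap iota p v)).

Definition xi_tangent {R : realType} {N k : nat} {B : manifold R N}
    {M : manifold R k} (xi : vfield B) (iota : M -> B) : Prop :=
  forall p, exists v, dmap iota p v = xi (iota p).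

Definition ind_xi {R : realType} {N k : nat} {B : manifold R N}
    {M : manifold R k} (g : B -> 'rV[R]_N -> 'rV[R]_N -> R) (xi : vfield B)
    (iota : M -> B) : vfield M :=
  fun p => tan_part g iota p (xi (iota p)).

Definition ind_eta {R : realType} {N k : nat} {B : manifold R N}
    {M : manifold R k} (eta : B -> 'rV[R]_N -> R) (iota : M -> B) :
    M -> 'rV[R]_k -> R :=
  fun p v => eta (iota p) (dmap iota p v).

(* The eigenspace of T^2 restricted to D, the orthogonal complement of xi, for
   the eigenvalue - a^2. [linfun] is faithful as both maps are linear. *)
Definition Deig {R : realType} {N k : nat} {B : manifold R N}
    {M : manifold R k} (phi : B -> 'rV[R]_N -> 'rV[R]_N) (xi : vfield B)
    (g : B -> 'rV[R]_N -> 'rV[R]_N -> R) (iota : M -> B) (p : M) (a : R) :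
    {vspace 'rV[R]_k} :=
  (lker (linfun (fun v : 'rV[R]_k =>
           ind_metric g iota p v (ind_xi g xi iota p) : R^o))
   :&: passmx.leigenspace (linfun (Tmap phi g iota p \o Tmap phi g iota p))
                   (- a ^+ 2))%VS.

Record almost_semi_invariant {R : realType} {N k l : nat} (B : manifold R N)
    (M : manifold R k) (phi : B -> 'rV[R]_N -> 'rV[R]_N) (xi : vfield B)
    (g : B -> 'rV[R]_N -> 'rV[R]_N -> R) (iota : M -> B)
    (lam : 'I_l -> M -> R) : Prop := {
  asi_range : forall i p, 0 < lam i p < 1;
  asi_distinct : forall p, injective (fun i => - lam i p ^+ 2);
  asi_eigenvalue : forall i p, Deig phi xi g iota p (lam i p) != 0%VS;
  asi_direct : forall p,
    directv (Deig phi xi g iota p 1 + Deig phi xi g iota p 0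
             + \sum_(i < l) Deig phi xi g iota p (lam i p)
             + <[ind_xi g xi iota p]>);
  asi_full : forall p,
    (Deig phi xi g iota p 1 + Deig phi xi g iota p 0
     + \sum_(i < l) Deig phi xi g iota p (lam i p)
     + <[ind_xi g xi iota p]>)%VS = fullv;
  asi_dim1 : forall p q,
    \dim (Deig phi xi g iota p 1) = \dim (Deig phi xi g iota q 1);
  asi_dim0 : forall p q,
    \dim (Deig phi xi g iota p 0) = \dim (Deig phi xi g iota q 0);
  asi_dim : forall i p q,
    \dim (Deig phi xi g iota p (lam i p)) = \dim (Deig phi xi g iota q (lam i q))
}.

Definition lambdas {R : realType} {k l : nat} {M : manifold R k}
    (lam : 'I_l -> M -> R) (p : M) : seq R :=
  [:: 1, 0 & [seq lam i p | i : 'I_l]].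

Definition orth_proj {R : realType} {k : nat}
    (b : 'rV[R]_k -> 'rV[R]_k -> R) (S : {vspace 'rV[R]_k}) (v : 'rV[R]_k) :
    'rV[R]_k :=
  xget 0 [set u | u \in S /\ forall w, w \in S -> b (v - u) w = 0].

Definition Uproj {R : realType} {N k : nat} {B : manifold R N}
    {M : manifold R k} (phi : B -> 'rV[R]_N -> 'rV[R]_N) (xi : vfield B)
    (g : B -> 'rV[R]_N -> 'rV[R]_N -> R) (iota : M -> B) (p : M) (a : R) :
    'rV[R]_k -> 'rV[R]_k :=
  orth_proj (ind_metric g iota p) (Deig phi xi g iota p a).

Record adapted_frame {R : realType} {N m : nat} (B : manifold R N)
    (M : manifold R m.+1) (g : B -> 'rV[R]_N -> 'rV[R]_N -> R) (xi : vfield B)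
    (iota : M -> B) (U : set M) (E : 'I_m.+1 -> vfield M) : Prop := {
  frame_smooth : forall i, smooth_vf U (E i);
  frame_orthonormal : forall p, U p -> forall i j,
    ind_metric g iota p (E i p) (E j p) = (i == j)%:R;
  frame_xi : forall p, U p -> E ord_max p = ind_xi g xi iota p
}.

Definition mean_curv {R : realType} {N m : nat} {B : manifold R N}
    {M : manifold R m.+1} (g : B -> 'rV[R]_N -> 'rV[R]_N -> R)
    (nab : vfield B -> vfield B -> vfield B) (iota : M -> B)
    (E : 'I_m.+1 -> vfield M) (p : M) : 'rV[R]_N :=
  m.+1%:R^-1 *: \sum_(i < m.+1) second_ff g nab iota (E i) (E i) p.

Definition minimal {R : realType} {N m : nat} {B : manifold R N}
    {M : manifold R m.+1} (g : B -> 'rV[R]_N -> 'rV[R]_N -> R) (xi : vfield B)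
    (nab : vfield B -> vfield B -> vfield B) (iota : M -> B) : Prop :=
  forall (U : set M) (E : 'I_m.+1 -> vfield M),
    open U -> adapted_frame g xi iota U E ->
    forall p, U p -> mean_curv g nab iota E p = 0.

Definition riem {R : realType} {N k : nat} {B : manifold R N}
    {M : manifold R k} (g : B -> 'rV[R]_N -> 'rV[R]_N -> R)
    (nab : vfield B -> vfield B -> vfield B) (iota : M -> B)
    (X Y Z W : vfield M) (p : M) : R :=
  ind_metric g iota p (curv (ind_conn g nab iota) X Y Z p) (W p).

Definition ricci {R : realType} {N m : nat} {B : manifold R N}
    {M : manifold R m.+1} (g : B -> 'rV[R]_N -> 'rV[R]_N -> R)
    (nab : vfield B -> vfield B -> vfield B) (iota : M -> B)
    (E : 'I_m.+1 -> vfield M) (X Y : vfield M) (p : M) : R :=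
  \sum_(i < m.+1) riem g nab iota X (E i) (E i) Y p.

Definition scal {R : realType} {N m : nat} {B : manifold R N}
    {M : manifold R m.+1} (g : B -> 'rV[R]_N -> 'rV[R]_N -> R)
    (nab : vfield B -> vfield B -> vfield B) (iota : M -> B)
    (E : 'I_m.+1 -> vfield M) (p : M) : R :=
  (m * m.+1)%:R^-1 *
  \sum_(i < m.+1) \sum_(j < m.+1) riem g nab iota (E i) (E j) (E j) (E i) p.

(* Main.v *)
Require Import Defs.
From HB Require Import structures.
From mathcomp Require Import all_boot all_order all_algebra.
From mathcomp Require Import all_classical all_reals all_analysis.
From mathcomp Require Import ring.
Import Order.TTheory GRing.Theory Num.Theory.
Import numFieldNormedType.Exports.
Local Open Scope classical_set_scope.
Local Open Scope ring_scope.
Set Implicit Arguments.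
Unset Strict Implicit.
Unset Printing Implicit Defensive.

(**
Write D for the Levi-Civita connection of the ambient manifold, D' for the
semisymmetric connection D'_X V = D_X V + eta(V) X, and h for the second
fundamental form. Differentiating twice along the submanifold and taking
tangential parts gives a Gauss equation ([gauss_equation]):

  R'(X,Y,Z,W) = Rbar(X,Y,Z,W) + (D_X eta)(Z) g(Y,W) - (D_Y eta)(Z) g(X,W)
     + eta(Z) (eta(Y) g(X,W) - eta(X) g(Y,W))
     + g(h(Y,Z), h(X,W)) - g(h(X,Z), h(Y,W)),

where (D_X eta)(Z) = g(Z, D_X xi) is a multiple of g(TX, Z). Tracing it over an
orthonormal frame with Y = Z = E_i and W = X, the terms in h become
g(sum h(E_i,E_i), h(X,X)) - sum |h(X,E_i)|^2 because h is symmetric. The first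
vanishes for a minimal submanifold and the second is nonpositive. The terms in
D eta vanish since T is skew. The curvature formula of the ambient space then
bounds the Ricci curvature by a combination of |X|^2, |TX|^2 and eta(X)^2
([ricci_le]).

It remains to express these through the eigenspaces of T^2. As T is skew, T^2
is self-adjoint, so its eigenspaces are orthogonal: |X|^2 is eta(X)^2 plus the
sum of the |U^a X|^2 ([norm_decomposition]), and |TX|^2 is the sum of the
a^2 |U^a X|^2 ([norm_skew_image]). This is (i). Summing over X = E_j, the squares
|U^a E_j|^2 add up to the trace of a projection, that is to the dimension of the
eigenspace ([trace_projection]), which gives (ii).

Most of the text builds the calculus behind the Gauss equation. The derivative
along the submanifold is given at each point in the chart centred there, while a
second derivative needs a formula valid near a point. The chart-free rules
[cov_sum] and [cov_restrict] determine it, and [cov_chart] rewrites it in one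
fixed chart. The three structural facts follow: no torsion ([cov_torsion]), the
product rule for g ([cov_product]), and commutation of derivatives up to the
ambient curvature ([cov_curvature]). Torsion and curvature rest on the symmetry
of second derivatives ([schwarz]): coordinate fields commute, and brackets are
commutators of derivations ([dfun_lie]). Smoothness of tangential parts comes
from the orthonormal frame ([tan_part_frame]).
*)

(** * Differentiable and C^k maps *)

Section Differentiability.
Context {R : realType} {V W : normedModType R}.
Implicit Types (f g : V -> W) (k : V -> R) (U : set V).

Lemma near_open U x (P : V -> Prop) : open U -> U x ->
  (forall y, U y -> P y) -> \near x, P x.
Proof. by move=> oU Ux UP; apply: filterS UP _; exact: open_nbhs_nbhs. Qed.

(** The differential of f at x is also one for g, since the remainder only
    involves values near x. *)
Lemma near_eq_diff f g x : (\near x, f x = g x) -> differentiable f x ->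
  differentiable g x.
Proof.
move=> fg df.
have E : g \o shift x = cst (g x) + 'd f x +o_ (0 : V) id.
  apply/eqaddoP => e e0.
  have [_ /eqaddoP/(_ e e0) H] := (diff_locallyP x f).1 df.
  have gx : f x = g x := nbhs_singleton fg.
  have fg' : \forall h \near (0 : V), f (h + x) = g (h + x).
    by move: fg; rewrite (near_shift 0) subr0.
  near=> h.
  have -> : (g \o shift x - (cst (g x) + 'd f x)) h
            = (f \o shift x - (cst (f x) + 'd f x)) h.
    by rewrite !fctE /= gx; congr (_ - _); symmetry; near: h.
  by near: h.
have dg : 'd g x = 'd f x :> (V -> W) by apply: diff_unique => //; apply: diff_continuous.
by apply/diff_locallyP; rewrite dg; split => //; exact: diff_continuous.
Unshelve. all: by end_near. Qed.

(* Naming scalar multiplication lets it carry a bilinear structure, from which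
   the product rule is read off. *)
Let scaleb (p : R) (q : W) : W := p *: q.

Lemma scaleb_is_bilinear : bilinear_for
    (GRing.Scale.Law.clone _ _ *:%R _) (GRing.Scale.Law.clone _ _ *:%R _) scaleb.
Proof.
split=> [u'|u] a x y /=; rewrite /scaleb; first by rewrite scalerDl scalerA.
by rewrite scalerDr !scalerA mulrC.
Qed.

HB.instance Definition _ :=
  bilinear_isBilinear.Build R R W W _ _ scaleb scaleb_is_bilinear.

Lemma scaleb_cont : continuous (fun p : R * W => scaleb p.1 p.2).
Proof. by move=> p; apply: cvgZ; [exact: cvg_fst | exact: cvg_snd]. Qed.

Lemma differentiable_scale k f x : differentiable k x -> differentiable f x ->
  differentiable (fun z => k z *: f z) x.
Proof.
move=> dk df.
apply: (@differentiable_comp _ _ _ _ (fun z => (k z, f z))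
  (fun p : R * W => scaleb p.1 p.2)); first exact: differentiable_pair.
exact: differentiable_bilin scaleb_cont.
Qed.

Lemma derive_scale k f x v : differentiable k x -> differentiable f x ->
  'D_v (fun z => k z *: f z) x = 'D_v k x *: f x + k x *: 'D_v f x.
Proof.
move=> dk df; rewrite !deriveE //; last exact: differentiable_scale.
rewrite (@diff_comp _ _ _ _ (fun z => (k z, f z))
  (fun p : R * W => scaleb p.1 p.2)) //; last 2 first.
- exact: differentiable_pair.
- exact: differentiable_bilin scaleb_cont.
rewrite /= diff_bilin; last exact: scaleb_cont.
by rewrite diff_pair //= addrC.
Qed.

Lemma deriveE_lin f x a u v : differentiable f x ->
  'D_(a *: u + v) f x = a *: 'D_u f x + 'D_v f x.
Proof. by move=> df; rewrite !deriveE // linearP. Qed.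

Lemma derive_chain {X : normedModType R} (f : W -> X) (g : V -> W) x v :
  differentiable g x -> differentiable f (g x) ->
  'D_v (f \o g) x = 'D_('D_v g x) f (g x).
Proof.
by move=> dg df; rewrite !deriveE //; [rewrite diff_comp | exact: differentiable_comp].
Qed.

End Differentiability.

Section Ck_algebra.
Context {R : realType} {V : normedModType R}.

Lemma Ck_congr {W : normedModType R} k (U : set V) (f g : V -> W) : open U ->
  (forall x, U x -> f x = g x) -> Ck k U f -> Ck k U g.
Proof.
move=> oU; elim: k f g => [|k IH] f g fg /=.
  move=> cf x Ux; have nfg := near_open oU Ux fg.
  change (g @ x --> g x); rewrite -(fg x Ux); apply: cvg_trans (cf x Ux).
  by apply: near_eq_cvg; apply: filterS nfg => y ->.
move=> [df Df]; split=> [x Ux|v].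
  by apply: near_eq_diff (df x Ux); exact: (near_open oU Ux fg).
apply: IH (Df v) => x Ux; apply: near_eq_derive; exact: (near_open oU Ux fg).
Qed.

Lemma Ck_sub {W : normedModType R} k (U U' : set V) (f : V -> W) :
  U' `<=` U -> Ck k U f -> Ck k U' f.
Proof.
move=> sU; elim: k f => [|k IH] f /=; first by move=> H x /sU; exact: H.
by move=> [df Df]; split=> [x /sU|v]; [exact: df | exact: IH].
Qed.

Lemma Ck_pred {W : normedModType R} k (U : set V) (f : V -> W) :
  Ck k.+1 U f -> Ck k U f.
Proof.
elim: k f => [|k IH] f [df Df].
  by move=> x Ux; exact/differentiable_continuous/df.
by split=> // v; exact: IH.
Qed.

Lemma Ck_cst {W : normedModType R} k (U : set V) (c : W) : Ck k U (fun _ => c).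
Proof.
elim: k c => [|k IH] c /=; first by move=> x _; exact: cvg_cst.
split=> [x _|v]; first exact: differentiable_cst.
rewrite (_ : 'D_v _ = fun _ => 0); first exact: IH.
by apply/funext => x; rewrite derive_cst.
Qed.

Lemma Ck_add {W : normedModType R} k (U : set V) (f g : V -> W) : open U ->
  Ck k U f -> Ck k U g -> Ck k U (fun x => f x + g x).
Proof.
move=> oU; elim: k f g => [|k IH] f g /=.
  by move=> cf cg x Ux; apply: cvgD; [exact: cf | exact: cg].
move=> [df Df] [dg Dg]; split=> [x Ux|v].
  by apply: differentiableD; [exact: df | exact: dg].
apply: Ck_congr oU _ (IH _ _ (Df v) (Dg v)) => x Ux /=.
by rewrite (@deriveD _ _ _ f g) //; apply: diff_derivable; [exact: df | exact: dg].
Qed.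

Lemma Ck_scale {W : normedModType R} k (U : set V) (a : V -> R) (f : V -> W) :
  open U -> Ck k U a -> Ck k U f -> Ck k U (fun x => a x *: f x).
Proof.
move=> oU; elim: k a f => [|k IH] a f.
  by move=> ca cf x Ux; apply: cvgZ; [exact: ca | exact: cf].
move=> Ha Hf; have [da Da] := Ha; have [df Df] := Hf; split=> [x Ux|v].
  by apply: differentiable_scale; [exact: da | exact: df].
apply: (@Ck_congr _ _ _ (fun x => 'D_v a x *: f x + a x *: 'D_v f x)) => //.
  by move=> x Ux; rewrite derive_scale //; [exact: da | exact: df].
apply: (Ck_add oU); apply: IH;
  [exact: Da | exact: Ck_pred Hf | exact: Ck_pred Ha | exact: Df].
Qed.

Lemma Ck_sum {W : normedModType R} k (U : set V) (I : Type) (r : seq I)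
    (f : I -> V -> W) : open U ->
  (forall i, Ck k U (f i)) -> Ck k U (fun x => \sum_(i <- r) f i x).
Proof.
move=> oU Hf; elim: r => [|i r IH].
  by apply: Ck_congr oU _ (Ck_cst k U 0) => x _; rewrite big_nil.
by apply: Ck_congr oU _ (Ck_add oU (Hf i) IH) => x _; rewrite big_cons.
Qed.

Lemma derive_coord N (F : V -> 'rV[R]_N) x v j : differentiable F x ->
  ('D_v F x) 0 j = 'D_v (fun y => F y 0 j) x.
Proof. by move=> dF; rewrite derive_mx ?mxE //; exact: diff_derivable. Qed.

Lemma diff_coord N (F : V -> 'rV[R]_N) x j : differentiable F x ->
  differentiable (fun y => F y 0 j) x.
Proof.
move=> dF; apply: (@differentiable_comp _ _ _ _ F (fun M : 'rV[R]_N => M 0 j)) => //.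
exact: differentiable_coord.
Qed.

Lemma Ck_coord N k (U : set V) (F : V -> 'rV[R]_N) j : open U ->
  Ck k U F -> Ck k U (fun x => F x 0 j).
Proof.
move=> oU; elim: k F => [|k IH] F.
  move=> cF x Ux; apply: (@continuous_comp _ _ _ F (fun M : 'rV[R]_N => M 0 j)).
    exact: cF.
  exact: coord_continuous.
move=> [dF DF]; split=> [x Ux|v]; first exact/diff_coord/dF.
apply: Ck_congr oU _ (IH _ (DF v)) => x Ux; rewrite derive_coord //; exact: dF.
Qed.

Lemma derive_row N {W : normedModType R} (f : 'rV[R]_N -> W) x v :
  differentiable f x -> 'D_v f x = \sum_j v 0 j *: 'D_(delta_mx 0 j) f x.
Proof.
move=> df; rewrite deriveE // {1}(row_sum_delta v) linear_sum.
by apply: eq_bigr => j _; rewrite linearZ deriveE.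
Qed.

(** By the chain rule a directional derivative of f \o g is a combination of
    partial derivatives of f, taken along g, with derivatives of g as
    coefficients; the order of each factor has dropped by one, so induction
    applies. *)
Lemma Ck_comp N {W : normedModType R} k (U : set V) (U' : set 'rV[R]_N)
    (f : 'rV[R]_N -> W) (g : V -> 'rV[R]_N) : open U ->
  (forall x, U x -> U' (g x)) -> Ck k U g -> Ck k U' f -> Ck k U (f \o g).
Proof.
move=> oU gU; elim: k f g gU => [|k IH] f g gU.
  by move=> cg cf x Ux; apply: continuous_comp; [exact: cg | exact/cf/gU].
move=> Hg Hf; have [dg Dg] := Hg; have [df Df] := Hf; split=> [x Ux|v].
  by apply: differentiable_comp; [exact: dg | exact/df/gU].
apply: (@Ck_congr _ _ _
  (fun x => \sum_j ('D_v g x) 0 j *: 'D_(delta_mx 0 j) f (g x))) => //.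
  move=> x Ux; rewrite (derive_chain v (dg x Ux) (df _ (gU x Ux))).
  by rewrite derive_row //; exact/df/gU.
apply: (Ck_sum _ oU) => j; apply: (Ck_scale oU); first exact: (Ck_coord j oU (Dg v)).
by apply: (IH ('D_(delta_mx 0 j) f) g gU (Ck_pred Hg)); exact: Df.
Qed.

End Ck_algebra.

(** * Symmetry of second derivatives *)

Section Schwarz.
Context {R : realType} {V : normedModType R}.

Lemma deriv_line (f : V -> R) (x u : V) s : differentiable f (x + s *: u) ->
  is_derive s 1 (fun s => f (x + s *: u)) ('D_u f (x + s *: u)).
Proof.
move=> df; have dl : differentiable (fun s : R => x + s *: u) s.
  by apply: differentiableD; [exact: differentiable_cst | exact: differentiableZl].
have dfl : differentiable (f \o (fun s : R => x + s *: u)) s.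
  exact: differentiable_comp.
apply: DeriveDef; first exact: diff_derivable.
rewrite (derive_chain _ dl df) //; congr ('D_ _ f _).
rewrite (@deriveD R R V (fun=> x) (fun s : R => s *: u)); [|exact: derivable_cst|].
  rewrite derive_cst add0r deriveE; last exact: differentiableZl.
    by rewrite diffZl //= diff_val scale1r.
by apply: diff_derivable; exact: differentiableZl.
Qed.

(** Apply the mean value theorem to the first difference in the direction v,
    as a function of the displacement along u, and then once more along v. *)
Lemma second_difference (U : set V) (f : V -> R) x (u v : V) (h : R) :
  0 < h -> Ck 2 U f ->
  (forall s t : R, 0 <= s <= h -> 0 <= t <= h -> U (x + s *: u + t *: v)) ->
  exists s t, [/\ 0 <= s <= h, 0 <= t <= h &
    f (x + h *: u + h *: v) - f (x + h *: u) - f (x + h *: v) + f x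
    = 'D_v ('D_u f) (x + s *: u + t *: v) * h * h].
Proof.
move=> h0 [df D2f] Uin.
have ah (s : R) : s \in `]0, h[ -> 0 <= s <= h by rewrite in_itv /= => /andP[/ltW-> /ltW->].
have cch (s : R) : s \in `[0, h] -> 0 <= s <= h by rewrite in_itv.
have a0 : 0 <= (0 : R) <= h by rewrite lexx ltW.
have ahh : 0 <= h <= h by rewrite lexx ltW.
have drv (F : R -> R) (s dF : R) : is_derive s (1 : R) F dF -> derivable F s 1 by case.
have der1 (s : R) : 0 <= s <= h -> is_derive s 1
    (fun s => f (x + h *: v + s *: u) - f (x + s *: u))
    ('D_u f (x + h *: v + s *: u) - 'D_u f (x + s *: u)).
  move=> sh; apply: is_deriveB; apply: deriv_line; apply: df.
    by rewrite addrAC; exact: Uin.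
  by rewrite -[_ + _ *: u]addr0 -(scale0r v); exact: Uin.
have [s sh E1] := MVT h0 (fun s sh => der1 s (ah s sh)) (derivable_within_continuous
  (fun s sh => drv _ _ _ (der1 s (cch s sh)))).
have der2 (t : R) : 0 <= t <= h -> is_derive t 1
    (fun t => 'D_u f (x + s *: u + t *: v)) ('D_v ('D_u f) (x + s *: u + t *: v)).
  by move=> th; apply: deriv_line; apply: (D2f u).1; apply: Uin => //; exact: ah.
have [t th E2] := MVT h0 (fun s sh => der2 s (ah s sh)) (derivable_within_continuous
  (fun s sh => drv _ _ _ (der2 s (cch s sh)))).
exists s, t; split; [exact: ah|exact: ah|].
move: E1 E2; rewrite !subr0 !scale0r !addr0 => E1 E2.
rewrite -E2 (addrAC x (s *: u)) -E1 (addrAC x (h *: v)) opprB addrA.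
by rewrite [RHS]addrAC.
Qed.

(** The second difference over a parallelogram is symmetric in its two sides, so
    each small parallelogram contains a point where one mixed derivative takes
    the value that the other takes at a second point of it. Continuity at x
    then identifies the two derivatives. *)
Lemma schwarz (U : set V) (f : V -> R) x (u v : V) : open U -> U x -> Ck 2 U f ->
  'D_u ('D_v f) x = 'D_v ('D_u f) x.
Proof.
move=> oU Ux Hf; have [df D2f] := Hf.
apply/eqP; rewrite -subr_eq0 -normr_le0; apply/ler_addgt0Pr => e e0; rewrite add0r.
have cont a b : \forall y \near x, `|'D_a ('D_b f) x - 'D_a ('D_b f) y| < e / 2.
  have : {for x, continuous ('D_a ('D_b f))} by exact: (D2f b).2.
  by move=> /cvgrPdist_lt; apply; rewrite divr_gt0.
pose P y := [/\ U y, `|'D_u ('D_v f) x - 'D_u ('D_v f) y| < e / 2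
               & `|'D_v ('D_u f) x - 'D_v ('D_u f) y| < e / 2].
have nP : \forall y \near x, P y.
  by apply: filterS3 (open_nbhs_nbhs (conj oU Ux)) (cont u v) (cont v u) => y; exact: And3.
have [d /= d0 dP] := (nbhs_ballP _ _).1 nP.
(* The side length h keeps the whole parallelogram in the ball of radius d; the
   summand 1 makes K positive even if u and v vanish. *)
pose K := `|u| + `|v| + 1.
have K0 : 0 < K by rewrite ltr_wpDl // addr_ge0.
pose h := d / 2 / K.
have h0 : 0 < h by rewrite !divr_gt0.
have inP a b s t : `|a| + `|b| + 1 = K -> 0 <= s <= h -> 0 <= t <= h ->
    P (x + s *: a + t *: b).
  move=> abK /andP[s0 sh] /andP[t0 th]; apply: dP.
  rewrite -ball_normE /= -addrA opprD addrA subrr sub0r normrN.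
  apply: le_lt_trans (ler_normD _ _) _; rewrite !normrZ !ger0_norm //.
  apply: (@le_lt_trans _ _ (h * K)).
    rewrite -abK mulrDr mulr1 mulrDr -[X in X <= _]addr0.
    by rewrite !lerD ?ler_wpM2r // ltW.
  by rewrite /h divfK ?gt_eqF // ltr_pdivrMr // ltr_pMr // ltr1n.
have [s [t [sh th E1]]] := second_difference h0 Hf
  (fun s t sh th => let: And3 H _ _ := inP u v s t erefl sh th in H).
have vuK : `|v| + `|u| + 1 = K by rewrite /K (addrC `|v|).
have [s' [t' [sh' th' E2]]] := second_difference h0 Hf
  (fun s t sh th => let: And3 H _ _ := inP v u s t vuK sh th in H).
have E : 'D_v ('D_u f) (x + s *: u + t *: v) = 'D_u ('D_v f) (x + s' *: v + t' *: u).
  have hn0 : h != 0 by rewrite gt_eqF.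
  apply: (mulIf hn0); apply: (mulIf hn0).
  refine (etrans (esym E1) (etrans _ E2)); congr (_ + _).
  by rewrite [LHS]addrAC (addrAC x (h *: u)).
have [_ _ H1] := inP u v s t erefl sh th.
have [_ H2 _] := inP v u s' t' vuK sh' th'.
have tri (A B C C' : R) : `|A - C| < e / 2 -> `|B - C'| < e / 2 -> C' = C ->
    `|A - B| <= e.
  move=> AC BC CC; rewrite CC in BC; rewrite [leRHS]splitr.
  have -> : A - B = (A - C) - (B - C) by rewrite opprB addrA subrK.
  by apply: le_trans (ler_normB _ _) _; apply: lerD; exact: ltW.
exact: tri H2 H1 E.
Qed.

Lemma schwarz_row N (U : set V) (F : V -> 'rV[R]_N) x (u v : V) :
  open U -> U x -> Ck 2 U F -> 'D_u ('D_v F) x = 'D_v ('D_u F) x.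
Proof.
move=> oU Ux HF; have [dF D2F] := HF; apply/rowP => j.
have E a b : ('D_a ('D_b F) x) 0 j = 'D_a ('D_b (fun y => F y 0 j)) x.
  rewrite derive_coord; last exact: (D2F b).1.
  apply: near_eq_derive; apply: near_open oU Ux _ => y Uy; rewrite derive_coord //.
  exact: dF.
refine (etrans (E u v) (etrans _ (esym (E v u)))).
have HFj := Ck_coord j oU HF.
have S := schwarz u v oU Ux HFj.
exact S.
Qed.

End Schwarz.

(** * Functions and vector fields on a manifold *)

Lemma Ck_local {R : realType} {V W : normedModType R} k (U : set V) (f : V -> W) :
  (forall x, U x -> exists Q, [/\ open Q, Q x & Ck k Q f]) -> Ck k U f.
Proof.
elim: k f => [|k IH] f Hf.
  by move=> x /Hf [Q [_ Qx cf]]; exact: cf.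
split=> [x /Hf [Q [_ Qx [df _]]]|v]; first exact: df.
apply: IH => x /Hf [Q [oQ Qx [_ Df]]].
by exists Q; split; [exact: oQ|exact: Qx|exact: Df].
Qed.

Section Charts.
Context {R : realType} {N : nat} {M : manifold R N}.
Implicit Types (b c p q : M) (U : set M) (v : 'rV[R]_N) (W : normedModType R).

Lemma chart_image_open c U : open U -> open (chart c @` (dom c `&` U)).
Proof.
move=> oU; rewrite openE => _ [q [dq Uq] <-].
have idq : (chart c @` dom c) (chart c q) by exists q.
have n1 : nbhs (chart c q) (chart c @` dom c).
  by apply: open_nbhs_nbhs; split=> //; exact: chart_open.
have n2 : nbhs (chart c q) (chart_inv c @^-1` U).
  apply: (chart_inv_continuous idq); apply: open_nbhs_nbhs; split=> //.
  by rewrite chartK.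
apply: filterS2 n1 n2 => _ [q' dq' <-] /=; rewrite chartK // => Uq'.
by exists q'.
Qed.

Arguments chart_image_open c [U] _.

Lemma openID U c : open U -> open (U `&` dom c).
Proof. by move=> oU; apply: openI => //; exact: dom_open. Qed.

Arguments openID [U] c _.

Lemma near_chart c q U (P : 'rV[R]_N -> Prop) : open U -> U q -> dom c q ->
  (forall q', U q' -> dom c q' -> P (chart c q')) -> \forall x \near chart c q, P x.
Proof.
move=> oU Uq dq UP.
have iq : (chart c @` (dom c `&` U)) (chart c q) by exists q.
apply: (near_open (chart_image_open c oU) iq).
by move=> _ [q' [dq' Uq'] <-]; exact: UP.
Qed.

Lemma near_chart_eq c q U {T : Type} (f h : 'rV[R]_N -> T) : open U -> U q ->
  dom c q -> (forall q', U q' -> dom c q' -> f (chart c q') = h (chart c q')) ->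
  \forall x \near chart c q, f x = h x.
Proof. exact: near_chart. Qed.

Lemma smooth_fun_diff {W} c q U (f : M -> W) : open U -> smooth_fun U f ->
  U q -> dom c q -> differentiable (f \o chart_inv c) (chart c q).
Proof. by move=> oU sf Uq dq; apply: (sf c 1%N).1; exists q. Qed.

Lemma smooth_chart c : smooth_fun (dom c) (chart c).
Proof. by move=> p; exact: chart_smooth. Qed.

Lemma smooth_fun_sub {W} U U' (f : M -> W) : U' `<=` U -> smooth_fun U f ->
  smooth_fun U' f.
Proof.
move=> sU sf p k; apply: Ck_sub (sf p k).
by move=> _ [q [dq Uq] <-]; exists q => //; split=> //; exact: sU.
Qed.

Lemma smooth_fun_congr {W} U (f h : M -> W) : open U ->
  (forall q, U q -> f q = h q) -> smooth_fun U f -> smooth_fun U h.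
Proof.
move=> oU fh sf p k; apply: Ck_congr (chart_image_open p oU) _ (sf p k).
by move=> _ [q [dq Uq] <-] /=; rewrite chartK // fh.
Qed.

Lemma smooth_fun_local {W} U (f : M -> W) :
  (forall q, U q -> exists Q, [/\ open Q, Q q & smooth_fun Q f]) -> smooth_fun U f.
Proof.
move=> Hf p k; apply: Ck_local => _ [q [dq /Hf [Q [oQ Qq sf]]] <-].
exists (chart p @` (dom p `&` Q)); split; [exact: chart_image_open|by exists q|].
exact: sf.
Qed.

Lemma smooth_fun_cst {W} U (a : W) : smooth_fun U (fun=> a).
Proof. by move=> p k; exact: Ck_cst. Qed.

Lemma smooth_fun_add {W} U (f h : M -> W) : open U -> smooth_fun U f ->
  smooth_fun U h -> smooth_fun U (fun q => f q + h q).
Proof.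
by move=> oU sf sh p k; exact: (Ck_add (chart_image_open p oU) (sf p k) (sh p k)).
Qed.

Lemma smooth_fun_scale {W} U (a : M -> R) (f : M -> W) : open U ->
  smooth_fun U a -> smooth_fun U f -> smooth_fun U (fun q => a q *: f q).
Proof.
by move=> oU sf sh p k; exact: (Ck_scale (chart_image_open p oU) (sf p k) (sh p k)).
Qed.

Lemma smooth_fun_sum {W} (I : Type) (r : seq I) U (f : I -> M -> W) : open U ->
  (forall i, smooth_fun U (f i)) -> smooth_fun U (fun q => \sum_(i <- r) f i q).
Proof.
by move=> oU sf p k; exact: (Ck_sum r (chart_image_open p oU) (fun i => sf i p k)).
Qed.

Lemma smooth_fun_coord n U (F : M -> 'rV[R]_n) j : open U -> smooth_fun U F ->
  smooth_fun U (fun q => F q 0 j).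
Proof.
by move=> oU sf p k; exact: (Ck_coord j (chart_image_open p oU) (sf p k)).
Qed.

Lemma smooth_fun_chartP {W} c U (f : M -> W) : open U -> U `<=` dom c ->
  smooth_on (chart c @` (dom c `&` U)) (f \o chart_inv c) -> smooth_fun U f.
Proof.
move=> oU sU sf p k.
have oi := chart_image_open p oU.
have Cc : Ck k (chart p @` (dom p `&` U)) (chart c \o chart_inv p).
  apply: Ck_sub (chart_smooth p c k) => _ [q [dq Uq] <-].
  by exists q => //; split=> //; exact: sU.
have im x : (chart p @` (dom p `&` U)) x ->
    (chart c @` (dom c `&` U)) ((chart c \o chart_inv p) x).
  move=> [q [dq Uq] <-] /=; rewrite chartK //.
  by exists q => //; split=> //; exact: sU.
apply: Ck_congr oi _ (Ck_comp oi im Cc (sf k)).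
by move=> _ [q [dq Uq] <-] /=; rewrite !chartK //; exact: sU.
Qed.

(** The chain rule for a change of chart. A tangent vector at q is given in the
    chart centred at q, so every formula in a chart fixed in advance starts
    from here. *)
Lemma derive_trans {W} b c q U (f : M -> W) v : open U -> smooth_fun U f -> U q ->
  dom b q -> dom c q ->
  'D_v (f \o chart_inv c) (chart c q)
  = 'D_('D_v (chart b \o chart_inv c) (chart c q)) (f \o chart_inv b) (chart b q).
Proof.
move=> oU sf Uq db dc.
have d1 : differentiable (chart b \o chart_inv c) (chart c q).
  exact: (smooth_fun_diff (dom_open b) (@smooth_chart b) db dc).
have E : (chart b \o chart_inv c) (chart c q) = chart b q by rewrite /= chartK.
have d2 : differentiable (f \o chart_inv b) ((chart b \o chart_inv c) (chart c q)).
  by rewrite E; exact: (smooth_fun_diff oU sf Uq db).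
rewrite -[in RHS]E -(derive_chain v d1 d2).
apply: near_eq_derive; apply: (near_chart_eq (dom_open b) db dc).
by move=> q' db' dc' /=; rewrite !chartK.
Qed.

Lemma dfun_chart {W} c q U (f : M -> W) v : open U -> smooth_fun U f -> U q ->
  dom c q ->
  dfun f q v = 'D_(dfun (chart c) q v) (f \o chart_inv c) (chart c q).
Proof. by move=> oU sf Uq dc; exact: (derive_trans v oU sf Uq dc (dom_center q)). Qed.

Lemma derive_chart_id c q v : dom c q ->
  'D_v (chart c \o chart_inv c) (chart c q) = v.
Proof.
move=> dc; transitivity ('D_v (@id 'rV[R]_N) (chart c q)); last exact: derive_id.
apply: near_eq_derive; apply: (near_chart_eq (dom_open c) dc dc).
by move=> q' dq' _ /=; rewrite chartK.
Qed.

Lemma dfun_chart_id q v : dfun (chart q) q v = v.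
Proof. exact: (derive_chart_id v (dom_center q)). Qed.

Lemma dfun_const_field {W} b q U (f : M -> W) v : open U -> smooth_fun U f ->
  U q -> dom b q ->
  dfun f q (const_field b v q) = 'D_v (f \o chart_inv b) (chart b q).
Proof.
by move=> oU sf Uq db; exact: esym (derive_trans v oU sf Uq (dom_center q) db).
Qed.

Lemma comps_const_field b c q v : dom b q -> dom c q ->
  comps c (const_field b v) q = 'D_v (chart c \o chart_inv b) (chart b q).
Proof.
by move=> db dc; exact: (dfun_const_field v (dom_open c) (@smooth_chart c) dc db).
Qed.

Lemma const_field_dfun_chart b q v : dom b q ->
  const_field b (dfun (chart b) q v) q = v.
Proof.
move=> db; rewrite -[RHS](dfun_chart_id q).
exact: esym (dfun_chart v (dom_open q) (@smooth_chart q) (dom_center q) db).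
Qed.

Lemma const_field_center b v : const_field b v b = v.
Proof. exact: (derive_chart_id v (dom_center b)). Qed.

Section dfun_rules.
Context {W : normedModType R} {U : set M} {q : M}.
Hypotheses (oU : open U) (Uq : U q).
Implicit Types f h : M -> W.

Lemma dfun_linear_dir f a u v : smooth_fun U f ->
  dfun f q (a *: u + v) = a *: dfun f q u + dfun f q v.
Proof.
by move=> sf; exact: (deriveE_lin a u v (smooth_fun_diff oU sf Uq (dom_center q))).
Qed.

Lemma dfun_congr f h v : (forall q', U q' -> f q' = h q') -> dfun f q v = dfun h q v.
Proof.
move=> fh; apply: near_eq_derive; apply: (near_chart_eq oU Uq (dom_center q)).
by move=> q' Uq' dq' /=; rewrite chartK // fh.
Qed.

Lemma dfun_add f h v : smooth_fun U f -> smooth_fun U h ->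
  dfun (fun q => f q + h q) q v = dfun f q v + dfun h q v.
Proof.
move=> sf sh; have dq := dom_center q.
have df := diff_derivable (v := v) (smooth_fun_diff oU sf Uq dq).
have dh := diff_derivable (v := v) (smooth_fun_diff oU sh Uq dq).
exact: (deriveD df dh).
Qed.

Lemma dfun_scale (a : M -> R) f v : smooth_fun U a -> smooth_fun U f ->
  dfun (fun q => a q *: f q) q v = dfun a q v *: f q + a q *: dfun f q v.
Proof.
move=> sa sf; have dq := dom_center q.
have := derive_scale v (smooth_fun_diff oU sa Uq dq) (smooth_fun_diff oU sf Uq dq).
by rewrite /= chartK.
Qed.

Lemma dfun_cst (a : W) v : dfun (fun _ : M => a) q v = 0.
Proof. exact: derive_cst. Qed.

End dfun_rules.

Lemma dfun_sum {W} U q (I : Type) (r : seq I) (f : I -> M -> W) v : open U -> U q ->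
  (forall i, smooth_fun U (f i)) ->
  dfun (fun q => \sum_(i <- r) f i q) q v = \sum_(i <- r) dfun (f i) q v.
Proof.
move=> oU Uq sf; elim: r => [|i r IH].
  rewrite big_nil; refine (etrans (dfun_congr oU Uq v _) (dfun_cst (0 : W) v)).
  by move=> q' _; rewrite big_nil.
rewrite big_cons -IH -(dfun_add oU Uq v (sf i) (smooth_fun_sum r oU sf)).
by apply: (dfun_congr oU Uq) => q' _; rewrite big_cons.
Qed.

Lemma dfun_coord n U q (F : M -> 'rV[R]_n) v j : open U -> U q -> smooth_fun U F ->
  (dfun F q v) 0 j = dfun (fun q => F q 0 j) q v.
Proof.
move=> oU Uq sF.
exact: (derive_coord v j (smooth_fun_diff oU sF Uq (dom_center q))).
Qed.

Lemma const_field_row b q v : dom b q ->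
  const_field b v q = \sum_j v 0 j *: const_field b (delta_mx 0 j) q.
Proof.
move=> db; apply: derive_row.
exact: (smooth_fun_diff (dom_open q) (@smooth_chart q) (dom_center q) db).
Qed.

Lemma vf_const_fields b (X : vfield M) q : dom b q ->
  X q = \sum_j comps b X q 0 j *: const_field b (delta_mx 0 j) q.
Proof.
by move=> db; rewrite -const_field_row // /comps const_field_dfun_chart.
Qed.

(** In a fixed chart this is the sum of the components of X times the partial
    derivatives of f, although the chart that defines dfun at q moves with q. *)
Lemma smooth_dfun {W} U (f : M -> W) (X : vfield M) : open U -> smooth_fun U f ->
  smooth_vf U X -> smooth_fun U (fun q => dfun f q (X q)).
Proof.
move=> oU sf sX c k; have oi := chart_image_open c oU.
apply: (@Ck_congr _ _ _ _ _ (fun x => \sum_j (comps c X (chart_inv c x)) 0 j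
   *: 'D_(delta_mx 0 j) (f \o chart_inv c) x)) => //.
  move=> _ [q [dq Uq] <-] /=; rewrite !chartK // (dfun_chart _ oU sf Uq dq).
  by rewrite -derive_row //; exact: (smooth_fun_diff oU sf Uq dq).
apply: (Ck_sum _ oi) => j; apply: (Ck_scale oi); last exact: (sf c k.+1).2.
apply: (Ck_coord (F := comps c X \o chart_inv c) j oi).
by apply: Ck_sub (sX c c k) => _ [q [dq Uq] <-]; exists q.
Qed.

Lemma smooth_vf_sub U U' (X : vfield M) : U' `<=` U -> smooth_vf U X -> smooth_vf U' X.
Proof. by move=> sU sX b; apply: smooth_fun_sub (sX b) => q [/sU Uq dq]; split. Qed.

Lemma smooth_vf_congr U (X Y : vfield M) : open U -> (forall q, U q -> X q = Y q) ->
  smooth_vf U X -> smooth_vf U Y.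
Proof.
move=> oU XY sX b; apply: smooth_fun_congr (openID b oU) _ (sX b).
by move=> q [Uq dq]; rewrite /comps XY.
Qed.

Lemma dfun0 {W} U q (f : M -> W) : open U -> U q -> smooth_fun U f -> dfun f q 0 = 0.
Proof.
move=> oU Uq sf; have := dfun_linear_dir oU Uq 1 0 0 sf.
by rewrite !scale1r addr0 => /eqP; rewrite -subr_eq subrr eq_sym => /eqP.
Qed.

Lemma dfun_scale_dir {W} U q (f : M -> W) a v : open U -> U q -> smooth_fun U f ->
  dfun f q (a *: v) = a *: dfun f q v.
Proof.
move=> oU Uq sf; have := dfun_linear_dir oU Uq a v 0 sf.
by rewrite (dfun0 oU Uq sf) !addr0.
Qed.

Lemma dfun_add_dir {W} U q (f : M -> W) u v : open U -> U q -> smooth_fun U f ->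
  dfun f q (u + v) = dfun f q u + dfun f q v.
Proof.
by move=> oU Uq sf; have := dfun_linear_dir oU Uq 1 u v sf; rewrite !scale1r.
Qed.

Lemma smooth_vf_scale U (a : M -> R) (X : vfield M) : open U -> smooth_fun U a ->
  smooth_vf U X -> smooth_vf U (fun q => a q *: X q).
Proof.
move=> oU sa sX b; have oi := openID b oU.
have sa' : smooth_fun (U `&` dom b) a by apply: smooth_fun_sub sa => q [].
apply: smooth_fun_congr oi _ (smooth_fun_scale oi sa' (sX b)) => q [Uq dq].
exact: esym (dfun_scale_dir _ _ (dom_open b) dq (@smooth_chart b)).
Qed.

Lemma smooth_vf_add U (X Y : vfield M) : open U -> smooth_vf U X ->
  smooth_vf U Y -> smooth_vf U (fun q => X q + Y q).
Proof.
move=> oU sX sY b; have oi := openID b oU.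
apply: smooth_fun_congr oi _ (smooth_fun_add oi (sX b) (sY b)) => q [Uq dq].
exact: esym (dfun_add_dir _ _ (dom_open b) dq (@smooth_chart b)).
Qed.

Lemma smooth_vf0 U : open U -> smooth_vf U (fun=> 0 : 'rV[R]_N).
Proof.
move=> oU b; apply: smooth_fun_congr (openID b oU) _ (smooth_fun_cst (U `&` dom b) 0).
move=> q [Uq dq]; exact: esym (dfun0 (dom_open b) dq (@smooth_chart b)).
Qed.

Lemma smooth_vf_sum (I : Type) (r : seq I) U (X : I -> vfield M) : open U ->
  (forall i, smooth_vf U (X i)) -> smooth_vf U (fun q => \sum_(i <- r) X i q).
Proof.
move=> oU sX; elim: r => [|i r IH].
  by apply: smooth_vf_congr oU _ (smooth_vf0 oU) => q _; rewrite big_nil.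
by apply: smooth_vf_congr oU _ (smooth_vf_add oU (sX i) IH) => q _; rewrite big_cons.
Qed.

Lemma smooth_const_field b v : smooth_vf (dom b) (const_field b v).
Proof.
move=> c; have oi := openID c (dom_open b).
apply: (@smooth_fun_chartP _ b _ _ oi); first by move=> q [].
have oi' := chart_image_open b oi => k.
apply: (Ck_congr (f := 'D_v (chart c \o chart_inv b)) oi').
  move=> _ [q [dq [_ cq]] <-]; refine (etrans (esym (comps_const_field v dq cq)) _).
  exact: (congr1 _ (esym (chartK dq))).
apply: Ck_sub ((chart_smooth b c k.+1).2 v).
by move=> _ [q [dq [_ cq]] <-]; exists q.
Qed.

(** The bracket compares the two mixed second derivatives of a transition map. *)
Lemma lie_const_field b u v q : dom b q ->
  lie (const_field b u) (const_field b v) q = 0.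
Proof.
move=> db; have dq := dom_center q.
have E x y : dfun (comps q (const_field b y)) q (const_field b x q)
    = 'D_x ('D_y (chart q \o chart_inv b)) (chart b q).
  refine (etrans (dfun_const_field x (openI (dom_open b) (dom_open q))
    (@smooth_const_field b y q) (conj db dq) db) _).
  apply: near_eq_derive; apply: (near_chart_eq (dom_open q) dq db).
  move=> q' dq' db'; refine (etrans _ (comps_const_field y db' dq')).
  exact: (congr1 _ (chartK db')).
have ib : (chart b @` (dom b `&` dom q)) (chart b q) by exists q.
refine (etrans (congr2 (fun x y : 'rV[R]_N => x - y) (E u v) (E v u)) _).
have S := schwarz_row u v (chart_image_open b (dom_open q)) ib (chart_smooth b q 2).
by apply/eqP; rewrite subr_eq0; apply/eqP; exact: S.
Qed.

(** The second derivatives of f cancel in the commutator by Schwarz's theorem;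
    what is left differentiates the components of the fields, which is how the
    bracket is defined. *)
Lemma dfun_lie U (f : M -> R) (X Y : vfield M) p : open U -> U p ->
  smooth_fun U f -> smooth_vf U X -> smooth_vf U Y ->
  dfun (fun q => dfun f q (Y q)) p (X p) - dfun (fun q => dfun f q (X q)) p (Y p)
  = dfun f p (lie X Y p).
Proof.
move=> oU Up sf sX sY; have dp := dom_center p.
pose F := f \o chart_inv p.
have dF q : U q -> dom p q -> differentiable F (chart p q).
  by move=> Uq dq; exact: (smooth_fun_diff oU sf Uq dq).
have [_ D2F] := sf p 2; have ip : (chart p @` (dom p `&` U)) (chart p p) by exists p.
have oU' := openID p oU; have Up' : (U `&` dom p) p by [].
have S u v : 'D_u ('D_v F) (chart p p) = 'D_v ('D_u F) (chart p p).
  exact: (schwarz u v (chart_image_open p oU) ip (sf p 2)).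
have dDF v : differentiable ('D_v F) (chart p p) := (D2F v).1 _ ip.
have E (A B : vfield M) : smooth_vf U A -> smooth_vf U B ->
    dfun (fun q => dfun f q (B q)) p (A p)
    = dfun f p (dfun (comps p B) p (A p)) + 'D_(A p) ('D_(B p) F) (chart p p).
  move=> sA sB.
  pose Bj j x := comps p B (chart_inv p x) 0 j.
  have dcB := smooth_fun_diff oU' (sB p) Up' dp.
  have dB j : differentiable (Bj j) (chart p p) := diff_coord j dcB.
  pose G := \sum_j (fun x => Bj j x *: 'D_(delta_mx 0 j) F x).
  transitivity ('D_(A p) G (chart p p)).
    apply: near_eq_derive; apply: (near_chart_eq oU Up dp) => q Uq dq.
    rewrite /G fct_sumE /Bj /= chartK // (dfun_chart _ oU sf Uq dq).
    exact: (derive_row _ (dF q Uq dq)).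
  rewrite /G derive_sum; last first.
    by move=> j; apply: diff_derivable; exact: (differentiable_scale (dB j) (dDF _)).
  have -> : \sum_i 'D_(A p) (fun x => Bj i x *: 'D_(delta_mx 0 i) F x) (chart p p)
     = \sum_i ('D_(A p) (Bj i) (chart p p) *: 'D_(delta_mx 0 i) F (chart p p)
        + Bj i (chart p p) *: 'D_(A p) ('D_(delta_mx 0 i) F) (chart p p)).
    by apply: eq_bigr => j _; exact: (derive_scale _ (dB j) (dDF _)).
  rewrite big_split /=; congr (_ + _).
    rewrite /dfun (derive_row _ (dF p Up dp)).
    apply: eq_bigr => j _; congr (_ *: _); exact: esym (derive_coord _ _ dcB).
  rewrite S (derive_row _ (dDF (A p))).
  apply: eq_bigr => j _; refine (congr2 (fun x y : R => x *: y) _ (S _ _)).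
  by rewrite /Bj chartK // /comps dfun_chart_id.
have sub (a b d d' : R) : d = d' -> (a + d) - (b + d') = a - b.
  by move=> ->; rewrite opprD addrACA subrr addr0.
refine (etrans (congr2 (fun x y : R => x - y) (E X Y sX sY) (E Y X sY sX)) _).
refine (etrans (sub _ _ _ _ (S _ _)) _); rewrite /lie.
have dN := dfun_scale_dir (-1) (dfun (comps p X) p (Y p)) oU Up sf.
by rewrite (dfun_add_dir _ _ oU Up sf); rewrite !scaleN1r in dN; rewrite -dN.
Qed.

End Charts.
Arguments chart_image_open {R N M} c [U] _.
Arguments openID {R N M} [U] c _.

(** * Connections are tensorial in the direction *)

Section Connections.
Context {R : realType} {N : nat} {B : manifold R N}.
Context {nab : vfield B -> vfield B -> vfield B}.
Hypothesis hnab : is_connection nab.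
Implicit Types (p b : B) (U : set B) (X Y : vfield B) (v : 'rV[R]_N).

(** The derivative of Y in the direction of a single vector v at p; the choice of
    the constant extension of v is harmless by tensoriality. *)
Definition nabv p v Y : 'rV[R]_N := nab (const_field p v) Y p.

Local Notation zero := (fun _ : B => 0 : 'rV[R]_N).

Lemma conn0l U Y p : open U -> smooth_vf U Y -> U p -> nab zero Y p = 0.
Proof.
move=> oU sY Up; have s0 := smooth_vf0 (M := B) oU.
have H := conn_scalel hnab oU (smooth_fun_cst U (0 : R)) s0 sY Up.
refine (etrans _ (etrans H (scale0r _))).
by apply: (conn_local hnab oU s0 sY) => // q _; rewrite scaler0.
Qed.

Lemma conn0r U X p : open U -> smooth_vf U X -> U p -> nab X zero p = 0.
Proof.
move=> oU sX Up; have s0 := smooth_vf0 (M := B) oU.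
have H := conn_leibniz hnab oU (smooth_fun_cst U (0 : R)) sX s0 Up.
refine (etrans _ (etrans H _)); last by rewrite scale0r addr0 scaler0.
by apply: (conn_local hnab oU sX s0) => // q _; rewrite scaler0.
Qed.

Lemma conn_suml (I : Type) (r : seq I) U (f : I -> B -> R) (X : I -> vfield B) Y p :
  open U -> U p -> (forall i, smooth_fun U (f i)) -> (forall i, smooth_vf U (X i)) ->
  smooth_vf U Y ->
  nab (fun q => \sum_(i <- r) f i q *: X i q) Y p
  = \sum_(i <- r) f i p *: nab (X i) Y p.
Proof.
move=> oU Up sf sX sY; have sfX i := smooth_vf_scale oU (sf i) (sX i).
elim: r => [|i r IH].
  rewrite big_nil; refine (etrans _ (conn0l oU sY Up)).
  by apply: (conn_local hnab oU (smooth_vf_sum [::] oU sfX) sY) => // q _; rewrite big_nil.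
rewrite big_cons -IH -(conn_scalel hnab oU (sf i) (sX i) sY Up).
rewrite -(conn_addl hnab oU (sfX i) (smooth_vf_sum r oU sfX) sY Up).
apply: (conn_local hnab oU (smooth_vf_sum (i :: r) oU sfX) sY) => // q _.
by rewrite big_cons.
Qed.

Lemma conn_sumr (I : Type) (r : seq I) U (f : I -> B -> R) X (Y : I -> vfield B) p :
  open U -> U p -> (forall i, smooth_fun U (f i)) -> smooth_vf U X ->
  (forall i, smooth_vf U (Y i)) ->
  nab X (fun q => \sum_(i <- r) f i q *: Y i q) p
  = \sum_(i <- r) (dfun (f i) p (X p) *: Y i p + f i p *: nab X (Y i) p).
Proof.
move=> oU Up sf sX sY; have sfY i := smooth_vf_scale oU (sf i) (sY i).
elim: r => [|i r IH].
  rewrite big_nil; refine (etrans _ (conn0r oU sX Up)).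
  by apply: (conn_local hnab oU sX (smooth_vf_sum [::] oU sfY)) => // q _; rewrite big_nil.
rewrite big_cons -IH -(conn_leibniz hnab oU (sf i) sX (sY i) Up).
rewrite -(conn_addr hnab oU sX (sfY i) (smooth_vf_sum r oU sfY) Up).
apply: (conn_local hnab oU sX (smooth_vf_sum (i :: r) oU sfY)) => // q _.
by rewrite big_cons.
Qed.

(** Tensoriality: X is a combination, with function coefficients, of the
    coordinate fields of a chart, and a connection is linear over functions in
    its first argument. *)
Lemma conn_expand b U X Y p : open U -> U p -> dom b p -> smooth_vf U X ->
  smooth_vf U Y ->
  nab X Y p = \sum_i comps b X p 0 i *: nab (const_field b (delta_mx 0 i)) Y p.
Proof.
move=> oU Up db sX sY; have oU' := openID b oU.
have sub : U `&` dom b `<=` U by move=> q [].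
have sub' : U `&` dom b `<=` dom b by move=> q [].
have sX' := smooth_vf_sub sub sX; have sY' := smooth_vf_sub sub sY.
have sf i : smooth_fun (U `&` dom b) (fun q => comps b X q 0 i).
  exact: (smooth_fun_coord i oU' (sX b)).
have sC (i : 'I_N) := smooth_vf_sub sub' (@smooth_const_field _ _ _ b (delta_mx 0 i)).
refine (etrans _ (conn_suml _ oU' (conj Up db) sf sC sY')).
apply: (conn_local hnab oU' sX' sY') => // q [_ dq].
exact: (vf_const_fields _ dq).
Qed.

Lemma nabv_expand b U p v Y : open U -> U p -> dom b p -> smooth_vf U Y ->
  nabv p v Y
  = \sum_i dfun (chart b) p v 0 i *: nab (const_field b (delta_mx 0 i)) Y p.
Proof.
move=> oU Up db sY; have oU' := openID p oU.
have sub : U `&` dom p `<=` U by move=> q [].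
have sub' : U `&` dom p `<=` dom p by move=> q [].
have sC := smooth_vf_sub sub' (@smooth_const_field _ _ _ p v).
rewrite /nabv (conn_expand oU' (conj Up (dom_center p)) db sC (smooth_vf_sub sub sY)).
by rewrite /comps const_field_center.
Qed.

Lemma nabv_sumr (I : Type) (r : seq I) U (f : I -> B -> R) (Y : I -> vfield B) p v :
  open U -> U p -> (forall i, smooth_fun U (f i)) -> (forall i, smooth_vf U (Y i)) ->
  nabv p v (fun q => \sum_(i <- r) f i q *: Y i q)
  = \sum_(i <- r) (dfun (f i) p v *: Y i p + f i p *: nabv p v (Y i)).
Proof.
move=> oU Up sf sY; have oU' := openID p oU.
have sub : U `&` dom p `<=` U by move=> q [].
have sub' : U `&` dom p `<=` dom p by move=> q [].
have sC := smooth_vf_sub sub' (@smooth_const_field _ _ _ p v).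
rewrite /nabv (conn_sumr r oU' (conj Up (dom_center p)) _ sC).
- by rewrite const_field_center.
- by move=> i; exact: smooth_fun_sub sub (sf i).
- by move=> i; exact: smooth_vf_sub sub (sY i).
Qed.

Lemma nabv_congr U p v Y Y' : open U -> U p -> smooth_vf U Y ->
  (forall q, U q -> Y q = Y' q) -> nabv p v Y = nabv p v Y'.
Proof.
move=> oU Up sY YY'; have oU' := openID p oU.
have sub : U `&` dom p `<=` U by move=> q [].
have sub' : U `&` dom p `<=` dom p by move=> q [].
have sC := smooth_vf_sub sub' (@smooth_const_field _ _ _ p v).
apply: (conn_local hnab oU' sC (smooth_vf_sub sub sY)) => //.
- by move=> q [Uq _]; exact: YY'.
- by split=> //; exact: dom_center.
Qed.

Lemma nabv_const_field p v w :
  nabv p v (const_field p w)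
  = \sum_j w 0 j *: nabv p v (const_field p (delta_mx 0 j)).
Proof.
have od := dom_open p; have dp := dom_center p.
rewrite (nabv_congr v od dp (@smooth_const_field _ _ _ p w)
  (fun q dq => const_field_row w dq)).
have sc j := smooth_fun_cst (dom p) (w 0 j).
rewrite (nabv_sumr _ v od dp sc (fun j => @smooth_const_field _ _ _ p (delta_mx 0 j))).
by apply: eq_bigr => j _; rewrite dfun_cst scale0r add0r.
Qed.

End Connections.

(** * Covariant derivatives along a submanifold *)

Section Along.
Context {R : realType} {N k : nat} {B : manifold R N} {M : manifold R k}.
Context {iota : M -> B} (hM : is_submanifold iota).
Implicit Types (b : B) (q : M) (O : set M) (X Y : vfield M) (V : M -> 'rV[R]_N).
Implicit Types (W : vfield B) (A : set B).

Lemma preimage_open A : open A -> open (iota @^-1` A).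
Proof. by move=> oA; apply: open_comp oA => q _; exact: (submfd_continuous hM). Qed.

Lemma openIpre O b : open O -> open (O `&` iota @^-1` dom b).
Proof. by move=> oO; apply: openI oO (preimage_open (dom_open b)). Qed.
Arguments openIpre {O} b _.

(** Only chart representations of iota are assumed smooth, so this is checked
    near each point, through the ambient chart centred at its image. *)
Lemma smooth_pull {T : normedModType R} A (f : B -> T) : open A -> smooth_fun A f ->
  smooth_fun (iota @^-1` A) (f \o iota).
Proof.
move=> oA sf; apply: smooth_fun_local => q Aq; set b := iota q.
pose Q := iota @^-1` (A `&` dom b).
have oQ : open Q := preimage_open (openID b oA).
exists Q; split=> //; first by split=> //; exact: dom_center.
move=> p n; have oi := chart_image_open p oQ.
have Ci : Ck n (chart p @` (dom p `&` Q)) ((chart b \o iota) \o chart_inv p).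
  apply: Ck_sub (submfd_smooth hM b p n) => _ [q' [dq' [_ bq']] <-].
  by exists q'.
have im x : (chart p @` (dom p `&` Q)) x ->
    (chart b @` (dom b `&` A)) (((chart b \o iota) \o chart_inv p) x).
  by move=> [q' [dq' [Aq' bq']] <-] /=; rewrite chartK //; exists (iota q').
apply: Ck_congr oi _ (Ck_comp oi im Ci (sf b n)).
by move=> _ [q' [dq' [Aq' bq']] <-] /=; rewrite chartK // chartK.
Qed.

Lemma dfun_pull {T : normedModType R} A (f : B -> T) q v : open A -> smooth_fun A f ->
  A (iota q) -> dfun (f \o iota) q v = dfun f (iota q) (dmap iota q v).
Proof.
move=> oA sf Aq; set b := iota q; have db : dom b b := dom_center b.
have dq := dom_center q.
have oD := preimage_open (dom_open b).
have d1 : differentiable ((chart b \o iota) \o chart_inv q) (chart q q).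
  exact: (smooth_fun_diff oD (submfd_smooth hM b) db dq).
have E : ((chart b \o iota) \o chart_inv q) (chart q q) = chart b b.
  by rewrite /= chartK.
have d2 : differentiable (f \o chart_inv b)
    (((chart b \o iota) \o chart_inv q) (chart q q)).
  by rewrite E; exact: (smooth_fun_diff oA sf Aq db).
rewrite /dfun /dmap /dfun -/b -[in RHS]E; refine (etrans _ (derive_chain v d1 d2)).
apply: near_eq_derive; apply: (near_chart_eq oD db dq).
by move=> q' bq' dq' /=; rewrite chartK // chartK.
Qed.

Lemma dmap_linear q a (u v : 'rV[R]_k) :
  dmap iota q (a *: u + v) = a *: dmap iota q u + dmap iota q v.
Proof.
by apply: (dfun_linear_dir (preimage_open (dom_open (iota q))) (dom_center (iota q)));
  exact: submfd_smooth.
Qed.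

(** V stands for a section of the ambient tangent bundle pulled back to the
    submanifold. *)
Definition smooth_along O V : Prop :=
  forall b, smooth_fun (O `&` iota @^-1` dom b) (fun q => dfun (chart b) (iota q) (V q)).

Lemma smooth_along_sub O O' V : O' `<=` O -> smooth_along O V -> smooth_along O' V.
Proof. by move=> sO sV b; apply: smooth_fun_sub (sV b) => q [/sO Oq bq]; split. Qed.

Lemma smooth_along_chart O V :
  (forall b, smooth_along (O `&` iota @^-1` dom b) V) -> smooth_along O V.
Proof.
by move=> sV b; apply: smooth_fun_sub (sV b b) => q [Oq bq]; split.
Qed.

Lemma smooth_along_congr O V V' : open O -> (forall q, O q -> V q = V' q) ->
  smooth_along O V -> smooth_along O V'.
Proof.
move=> oO VV sV b; apply: smooth_fun_congr (openIpre b oO) _ (sV b).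
by move=> q [Oq _]; rewrite VV.
Qed.

Lemma smooth_along_scale O (f : M -> R) V : open O -> smooth_fun O f ->
  smooth_along O V -> smooth_along O (fun q => f q *: V q).
Proof.
move=> oO sf sV b; have oi := openIpre b oO.
have sf' : smooth_fun (O `&` iota @^-1` dom b) f by apply: smooth_fun_sub sf => q [].
apply: smooth_fun_congr oi _ (smooth_fun_scale oi sf' (sV b)) => q [Oq dq].
exact: esym (dfun_scale_dir _ _ (dom_open b) dq (@smooth_chart _ _ _ b)).
Qed.

Lemma smooth_along_add O V V' : open O -> smooth_along O V -> smooth_along O V' ->
  smooth_along O (fun q => V q + V' q).
Proof.
move=> oO sV sV' b; have oi := openIpre b oO.
apply: smooth_fun_congr oi _ (smooth_fun_add oi (sV b) (sV' b)) => q [Oq dq].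
exact: esym (dfun_add_dir _ _ (dom_open b) dq (@smooth_chart _ _ _ b)).
Qed.

Lemma smooth_along_restrict A W : open A -> smooth_vf A W ->
  smooth_along (iota @^-1` A) (W \o iota).
Proof.
by move=> oA sW b; exact: (smooth_pull (openID b oA) (sW b)).
Qed.

Lemma smooth_along0 O : open O -> smooth_along O (fun=> 0).
Proof.
move=> oO b.
apply: smooth_fun_congr (openIpre b oO) _ (smooth_fun_cst (O `&` iota @^-1` dom b) 0).
move=> q [Oq dq]; exact: esym (dfun0 (dom_open b) dq (@smooth_chart _ _ _ b)).
Qed.

Lemma smooth_along_sum (I : Type) (r : seq I) O (V : I -> M -> 'rV[R]_N) : open O ->
  (forall i, smooth_along O (V i)) -> smooth_along O (fun q => \sum_(i <- r) V i q).
Proof.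
move=> oO sV; elim: r => [|i r IH].
  by apply: smooth_along_congr oO _ (smooth_along0 oO) => q _; rewrite big_nil.
by apply: smooth_along_congr oO _ (smooth_along_add oO (sV i) IH) => q _; rewrite big_cons.
Qed.

Lemma dfun_chart_dmap b q v : dom b (iota q) ->
  dfun (chart b) (iota q) (dmap iota q v) = dfun (chart b \o iota) q v.
Proof. by move=> bq; exact: esym (dfun_pull v (dom_open b) (@smooth_chart _ _ _ b) bq). Qed.

Lemma smooth_along_dmap O X : open O -> smooth_vf O X ->
  smooth_along O (fun q => dmap iota q (X q)).
Proof.
move=> oO sX b; have oi := openIpre b oO.
have sX' : smooth_vf (O `&` iota @^-1` dom b) X by apply: smooth_vf_sub sX => q [].
have sb : smooth_fun (O `&` iota @^-1` dom b) (chart b \o iota).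
  by apply: smooth_fun_sub (submfd_smooth hM b) => q [].
apply: smooth_fun_congr oi _ (smooth_dfun oi sb sX') => q [_ bq].
exact: esym (dfun_chart_dmap _ bq).
Qed.

Definition acomp b V q j : R := dfun (chart b) (iota q) (V q) 0 j.

Lemma smooth_acomp O b V j : open O -> smooth_along O V -> O `<=` iota @^-1` dom b ->
  smooth_fun O (fun q => acomp b V q j).
Proof.
move=> oO sV sb; apply: (smooth_fun_coord j oO); apply: smooth_fun_sub (sV b).
by move=> q Oq; split=> //; exact: sb.
Qed.

Lemma acomp_expand b V q : dom b (iota q) ->
  V q = \sum_j acomp b V q j *: const_field b (delta_mx 0 j) (iota q).
Proof. by move=> bq; rewrite -const_field_row // const_field_dfun_chart. Qed.

Section Cov.
Context {nab : vfield B -> vfield B -> vfield B}.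
Hypothesis hnab : is_connection nab.
Local Notation D := (cov_along nab iota).
Local Notation nabv := (@nabv R N B nab).
Local Notation "'d_ b j" := (const_field b (delta_mx 0 j)) (at level 10, b, j at level 8).

Lemma covE X V q : D X V q =
  dfun (fun q' => dfun (chart (iota q)) (iota q') (V q')) q (X q)
  + nabv (iota q) (dmap iota q (X q)) (const_field (iota q) (V q)).
Proof. by []. Qed.


Lemma cov_congr O X V V' q : open O -> O q -> (forall q', O q' -> V q' = V' q') ->
  D X V q = D X V' q.
Proof.
move=> oO Oq VV.
refine (congr2 (fun x y : 'rV[R]_N => x + y) (dfun_congr oO Oq _ _) _).
  by move=> q' Oq'; rewrite VV.
by rewrite (VV q Oq).
Qed.

(** The Leibniz rule, for several fields at once: both the derivative of the
    components and the Christoffel part are linear in the field. *)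
Lemma cov_sum (I : Type) (r : seq I) O X (f : I -> M -> R) (V : I -> M -> 'rV[R]_N) q :
  open O -> O q -> (forall i, smooth_fun O (f i)) -> (forall i, smooth_along O (V i)) ->
  D X (fun q => \sum_(i <- r) f i q *: V i q) q
  = \sum_(i <- r) (dfun (f i) q (X q) *: V i q + f i q *: D X (V i) q).
Proof.
move=> oO Oq sf sV; set b := iota q.
have bb : dom b b := dom_center b.
have oi := openIpre b oO; have iq : (O `&` iota @^-1` dom b) q by split.
have sf' i : smooth_fun (O `&` iota @^-1` dom b) (f i).
  by apply: smooth_fun_sub (sf i) => q' [].
have sc := @smooth_chart _ _ B b.
have E : dfun (fun q' => dfun (chart b) (iota q') (\sum_(i <- r) f i q' *: V i q')) q (X q)
    = \sum_(i <- r) (dfun (f i) q (X q) *: V i q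
        + f i q *: dfun (fun q' => dfun (chart b) (iota q') (V i q')) q (X q)).
  transitivity (dfun
    (fun q' => \sum_(i <- r) f i q' *: dfun (chart b) (iota q') (V i q')) q (X q)).
    apply: (dfun_congr oi iq) => q' [_ bq'].
    elim: r => [|i r IH]; first by rewrite !big_nil; exact: (dfun0 (dom_open b) bq' sc).
    rewrite !big_cons -IH (dfun_add_dir _ _ (dom_open b) bq' sc).
    by rewrite (dfun_scale_dir _ _ (dom_open b) bq' sc).
  rewrite (dfun_sum r _ oi iq (fun i => smooth_fun_scale oi (sf' i) (sV i b))).
  apply: eq_bigr => i _; rewrite (dfun_scale oi iq _ (sf' i) (sV i b)).
  by rewrite dfun_chart_id.
have F : nabv b (dmap iota q (X q)) (const_field b (\sum_(i <- r) f i q *: V i q))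
    = \sum_(i <- r) f i q *: nabv b (dmap iota q (X q)) (const_field b (V i q)).
  refine (etrans (nabv_const_field hnab b _ _) _).
  under eq_bigr => j _ do rewrite summxE scaler_suml.
  rewrite exchange_big; apply: eq_bigr => i _ /=.
  refine (etrans _ (congr1 _ (esym (nabv_const_field hnab b _ _)))).
  rewrite scaler_sumr; apply: eq_bigr => j _.
  by rewrite mxE scalerA.
rewrite covE E F -big_split; apply: eq_bigr => i _ /=.
by rewrite covE scalerDr addrA.
Qed.

Lemma cov_add O X V V' q : open O -> O q -> smooth_along O V -> smooth_along O V' ->
  D X (fun q => V q + V' q) q = D X V q + D X V' q.
Proof.
move=> oO Oq sV sV'.
pose W (i : bool) := if i then V else V'.
have sW i : smooth_along O (W i).
  by case: i; [exact: sV | exact: sV'].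
have E := cov_sum [:: true; false] X oO Oq (fun=> smooth_fun_cst O (1 : R)) sW.
refine (etrans _ (etrans E _)).
  apply: (cov_congr X oO Oq) => q' _.
  by rewrite big_cons big_cons big_nil !scale1r addr0.
have c0 (c : R) (u w : 'rV[R]_N) : c = 0 -> c *: u + 1 *: w = w.
  by move=> ->; rewrite scale0r add0r scale1r.
have sum2 (F : bool -> 'rV[R]_N) : \sum_(i <- [:: true; false]) F i = F true + F false.
  by rewrite big_cons big_cons big_nil addr0.
refine (etrans (sum2 _) (congr2 (fun x y : 'rV[R]_N => x + y) (c0 _ _ _ _) (c0 _ _ _ _)));
  exact: dfun_cst.
Qed.

Lemma cov_scale O X (f : M -> R) V q : open O -> O q -> smooth_fun O f -> smooth_along O V ->
  D X (fun q => f q *: V q) q = dfun f q (X q) *: V q + f q *: D X V q.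
Proof.
move=> oO Oq sf sV.
have E := cov_sum [:: tt] X oO Oq (fun=> sf) (fun=> sV).
have sum1 (F : unit -> 'rV[R]_N) : \sum_(i <- [:: tt]) F i = F tt.
  by rewrite big_cons big_nil addr0.
refine (etrans _ (etrans E (sum1 _))).
by apply: (cov_congr X oO Oq) => q' _; rewrite big_cons big_nil addr0.
Qed.

(** On a field that extends to the ambient manifold the derivative along iota is
    the ambient one. Together with the Leibniz rule this determines it, and
    frees it from the moving chart of its definition. *)
Lemma cov_restrict A X W q : open A -> A (iota q) -> smooth_vf A W ->
  D X (W \o iota) q = nabv (iota q) (dmap iota q (X q)) W.
Proof.
move=> oA Aq sW; rewrite covE; set b := iota q; set w := dmap _ _ _.
have bb := dom_center b; have oi := openID b oA; have ib : (A `&` dom b) b by [].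
have sub : A `&` dom b `<=` A by move=> ? [].
have sub' : A `&` dom b `<=` dom b by move=> ? [].
have sWj j : smooth_fun (A `&` dom b) (fun r => comps b W r 0 j).
  exact: (smooth_fun_coord j oi (sW b)).
have sd j := smooth_vf_sub sub' (@smooth_const_field _ _ B b (delta_mx 0 j)).
rewrite (nabv_congr hnab w oi ib (smooth_vf_sub sub sW)
  (fun r ir => vf_const_fields W (sub' r ir))).
rewrite (nabv_sumr hnab _ w oi ib sWj sd) big_split /=; congr (_ + _).
  transitivity (dfun (comps b W) b w).
    exact: (dfun_pull (X q) oi (sW b) ib).
  rewrite [LHS]row_sum_delta; apply: eq_bigr => j _.
  by rewrite const_field_center (dfun_coord w j oi ib (sW b)).
refine (etrans (nabv_const_field hnab b _ _) _); apply: eq_bigr => j _.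
by rewrite /comps dfun_chart_id.
Qed.

(** Expand V in the coordinate fields of the chart at b, which extend to the
    ambient manifold. The point is that b does not depend on q, so that this
    expression can be differentiated again. *)
Lemma cov_chart b O X V q : open O -> O q -> O `<=` iota @^-1` dom b ->
  smooth_along O V ->
  D X V q = \sum_j (dfun (fun q => acomp b V q j) q (X q) *: 'd_ b j (iota q)
    + acomp b V q j *: \sum_i acomp b (fun q => dmap iota q (X q)) q i
        *: nab ('d_ b i) ('d_ b j) (iota q)).
Proof.
move=> oO Oq sb sV; have db := dom_open b; have bq := sb q Oq.
have sd j := @smooth_const_field _ _ B b (delta_mx 0 j).
have sa j : smooth_along O ('d_ b j \o iota).
  exact: smooth_along_sub sb (smooth_along_restrict db (sd j)).
rewrite (cov_congr X oO Oq (fun q' Oq' => acomp_expand V (sb q' Oq'))).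
rewrite (cov_sum _ X oO Oq (fun j => smooth_acomp j oO sV sb) sa).
apply: eq_bigr => j _; congr (_ + _ *: _).
by rewrite (cov_restrict X db bq (sd j)) (nabv_expand hnab _ db bq bq (sd j)).
Qed.

Lemma smooth_cov O X V : open O -> smooth_vf O X -> smooth_along O V ->
  smooth_along O (D X V).
Proof.
move=> oO sX sV; apply: smooth_along_chart => b.
set Q := O `&` _; have oQ : open Q := openIpre b oO.
have QO : Q `<=` O by move=> q [].
have Qb : Q `<=` iota @^-1` dom b by move=> q [].
have sV' := smooth_along_sub QO sV; have sX' := smooth_vf_sub QO sX.
have sdX := smooth_along_dmap oQ sX'; have db := dom_open b.
have sd j := @smooth_const_field _ _ B b (delta_mx 0 j).
have sr W : smooth_vf (dom b) W -> smooth_along Q (W \o iota).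
  by move=> sW; exact: smooth_along_sub Qb (smooth_along_restrict db sW).
apply: (smooth_along_congr oQ (fun q Qq => esym (cov_chart X oQ Qq Qb sV'))).
apply: (smooth_along_sum _ oQ) => j; apply: (smooth_along_add oQ).
  have sj := smooth_dfun oQ (smooth_acomp j oQ sV' Qb) sX'.
  exact: (smooth_along_scale oQ sj (sr _ (sd j))).
apply: (smooth_along_scale oQ (smooth_acomp j oQ sV' Qb)).
apply: (smooth_along_sum _ oQ) => i.
apply: (smooth_along_scale oQ (smooth_acomp i oQ sdX Qb)).
exact: (sr _ (conn_smooth hnab db (sd i) (sd j))).
Qed.

End Cov.
End Along.

(** * Torsion, metric and curvature along a submanifold *)

(** The linear algebra behind the commutator of two covariant derivatives in a
    chart. Here d j are the coordinate fields, G i j their derivatives and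
    H a i j their second derivatives; V, x and y are the components of the
    differentiated field and of the two directions, while XV, XYV, Xy and so on
    are derivatives of such components. The products of first derivatives of V
    with components of x and y are symmetric and cancel. *)
Lemma curvature_bookkeeping (R : comNzRingType) (N : nat)
    (d : 'I_N -> 'rV[R]_N) (G : 'I_N -> 'I_N -> 'rV[R]_N)
    (H : 'I_N -> 'I_N -> 'I_N -> 'rV[R]_N)
    (V XV YV XYV YXV LV x y Xy Yx Lc : 'I_N -> R) :
  (forall j, XYV j - YXV j = LV j) -> (forall i, Xy i - Yx i = Lc i) ->
  (\sum_j (XYV j *: d j + YV j *: \sum_i x i *: G i j)
   + \sum_j \sum_i ((XV j * y i + V j * Xy i) *: G i j
                    + (V j * y i) *: \sum_a x a *: H a i j))
  - (\sum_j (YXV j *: d j + XV j *: \sum_i y i *: G i j)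
   + \sum_j \sum_i ((YV j * x i + V j * Yx i) *: G i j
                    + (V j * x i) *: \sum_a y a *: H a i j))
  - \sum_j (LV j *: d j + V j *: \sum_i Lc i *: G i j)
  = \sum_j \sum_i \sum_a (V j * y i * x a) *: (H a i j - H i a j).
Proof.
move=> HLV HLc; rewrite -!big_split -!sumrB /=; apply: eq_bigr => j _.
rewrite -HLV; under [\sum_i Lc i *: _]eq_bigr do rewrite -HLc scalerBl.
rewrite sumrB !big_split /=.
have sw (u w : 'I_N -> R) : \sum_i (V j * u i) *: (\sum_a w a *: H a i j)
    = \sum_i \sum_a (V j * u i * w a) *: H a i j.
  by apply: eq_bigr => i _; rewrite scaler_sumr; apply: eq_bigr => a _; rewrite scalerA.
rewrite !sw [X in _ - (_ + (_ + X))]exchange_big /=.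
under [RHS]eq_bigr do (under eq_bigr do rewrite scalerBr; rewrite sumrB).
rewrite sumrB.
have -> : \sum_i \sum_a (V j * x a * y i) *: H i a j
    = \sum_i \sum_a (V j * y i * x a) *: H i a j.
  by apply: eq_bigr => i _; apply: eq_bigr => a _; rewrite mulrAC.
set P1 := \sum_(i < N) \sum_(a < N) (V j * y i * x a) *: H a i j.
set P2 := \sum_(i < N) \sum_(a < N) (V j * y i * x a) *: H i a j.
have c2 (u v w z : 'I_N -> R) : \sum_i (u j * v i + w j * z i) *: G i j
    = u j *: (\sum_i v i *: G i j) + w j *: \sum_i z i *: G i j.
  rewrite !scaler_sumr -big_split; apply: eq_bigr => i _.
  by rewrite scalerDl !scalerA.
rewrite !c2; set SX := \sum_i x i *: _; set SY := \sum_i y i *: _.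
set TX := \sum_i Xy i *: _; set TY := \sum_i Yx i *: _.
by apply/rowP => k; rewrite !mxE; ring.
Qed.

Section AlongCurvature.
Context {R : realType} {N k : nat} {B : manifold R N} {M : manifold R k}.
Context {iota : M -> B} (hM : is_submanifold iota).
Context {g : B -> 'rV[R]_N -> 'rV[R]_N -> R} (hg : is_metric g).
Context {nab : vfield B -> vfield B -> vfield B} (hLC : is_levi_civita g nab).
Implicit Types (b : B) (q : M) (O : set M) (X Y : vfield M) (V W : M -> 'rV[R]_N).
Let hnab := lc_connection hLC.
Local Notation D := (cov_along nab iota).
Local Notation push X := (fun q => dmap iota q (X q)).
Local Notation e_ j := (delta_mx 0 j : 'rV[R]_N).

(** In the chart centred at the image of q, the Christoffel parts agree because
    coordinate fields commute and nab has no torsion, and the derivatives of the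
    components of iota differ by the bracket. *)
Lemma cov_torsion O X Y q : open O -> O q -> smooth_vf O X -> smooth_vf O Y ->
  D X (push Y) q - D Y (push X) q = dmap iota q (lie X Y q).
Proof.
move=> oO Oq sX sY; set b := iota q; have bb := dom_center b; have db := dom_open b.
pose Q := O `&` iota @^-1` dom b; have oQ : open Q := openIpre hM b oO.
have Qq : Q q by [].
have QO : Q `<=` O by move=> ? [].
have Qb : Q `<=` iota @^-1` dom b by move=> ? [].
have sX' := smooth_vf_sub QO sX; have sY' := smooth_vf_sub QO sY.
have sF : smooth_fun Q (chart b \o iota) := smooth_fun_sub Qb (submfd_smooth hM b).
have E Z Z' : dfun (fun q' => dfun (chart b) (iota q') (dmap iota q' (Z q'))) q (Z' q)
    = dfun (fun q' => dfun (chart b \o iota) q' (Z q')) q (Z' q).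
  by apply: (dfun_congr oQ Qq) => q' [_ bq']; exact: (dfun_chart_dmap hM).
have T : nabv (nab := nab) b (dmap iota q (X q)) (const_field b (dmap iota q (Y q)))
    - nabv (nab := nab) b (dmap iota q (Y q)) (const_field b (dmap iota q (X q))) = 0.
  refine (etrans (lc_torsion_free hLC db _ _ bb) (lie_const_field _ _ bb));
    exact: smooth_const_field.
have sub4 (a1 a2 n1 n2 : 'rV[R]_N) : n1 - n2 = 0 -> a1 + n1 - (a2 + n2) = a1 - a2.
  by move=> n12; rewrite opprD addrACA n12 addr0.
refine (etrans (sub4 _ _ _ _ T) _).
refine (etrans (congr2 (fun x y : 'rV[R]_N => x - y) (E Y X) (E X Y)) _).
apply/rowP => j; pose Fj q := (chart b \o iota) q 0 j.
have sFj : smooth_fun Q Fj := smooth_fun_coord j oQ sF.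
have C Z Z' : smooth_vf Q Z ->
    (dfun (fun q' => dfun (chart b \o iota) q' (Z q')) q (Z' q)) 0 j
    = dfun (fun q' => dfun Fj q' (Z q')) q (Z' q).
  move=> sZ; refine (etrans (dfun_coord _ j oQ Qq (smooth_dfun oQ sF sZ)) _).
  by apply: (dfun_congr oQ Qq) => q' Qq'; exact: (dfun_coord _ j oQ Qq' sF).
have mxB (u v : 'rV[R]_N) : (u - v) 0 j = u 0 j - v 0 j by rewrite !mxE.
refine (etrans (mxB _ _) _).
refine (etrans (congr2 (fun x y : R => x - y) (C Y X sY') (C X Y sX')) _).
refine (etrans (dfun_lie oQ Qq sFj sX' sY') _).
exact: esym (dfun_coord (lie X Y q) j oQ Qq sF).
Qed.

Lemma metric_suml p (I : Type) (r : seq I) (a : I -> R) (u : I -> 'rV[R]_N) w :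
  g p (\sum_(i <- r) a i *: u i) w = \sum_(i <- r) a i * g p (u i) w.
Proof.
elim: r => [|i r IH]; last by rewrite !big_cons (metric_linear hg) IH.
rewrite !big_nil; have := metric_linear hg p 1 0 0 w.
by rewrite scale1r addr0 mul1r => /eqP; rewrite -subr_eq subrr eq_sym => /eqP.
Qed.

(** Smoothness of the inner product is kept together with the product rule: both
    pass to combinations of fields by the same argument. *)
Definition product_rule O X q V W : Prop :=
  smooth_fun O (fun q => g (iota q) (V q) (W q)) /\
  dfun (fun q => g (iota q) (V q) (W q)) q (X q)
  = g (iota q) (D X V q) (W q) + g (iota q) (V q) (D X W q).

Lemma product_rule_sym O X q V W : open O -> O q ->
  product_rule O X q V W -> product_rule O X q W V.
Proof.
move=> oO Oq [sVW E].
have sym q' : O q' -> g (iota q') (V q') (W q') = g (iota q') (W q') (V q').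
  by move=> _; exact: (Defs.metric_sym hg).
split; first exact: smooth_fun_congr oO sym sVW.
refine (etrans (esym (dfun_congr oO Oq (X q) sym)) (etrans E _)).
exact: (etrans (addrC _ _) (congr2 (fun x y : R => x + y)
  (Defs.metric_sym hg _ _ _) (Defs.metric_sym hg _ _ _))).
Qed.

Lemma product_rule_sum (I : Type) (r : seq I) O X q (f : I -> M -> R)
    (V : I -> M -> 'rV[R]_N) W : open O -> O q ->
  (forall i, smooth_fun O (f i)) -> (forall i, smooth_along (iota := iota) O (V i)) ->
  (forall i, product_rule O X q (V i) W) ->
  product_rule O X q (fun q => \sum_(i <- r) f i q *: V i q) W.
Proof.
move=> oO Oq sf sV PV.
have E q' : O q' -> \sum_(i <- r) f i q' *: g (iota q') (V i q') (W q')
    = g (iota q') (\sum_(i <- r) f i q' *: V i q') (W q').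
  by move=> _; rewrite metric_suml.
have sfg i : smooth_fun O (fun q' => f i q' *: g (iota q') (V i q') (W q')).
  exact: (smooth_fun_scale oO (sf i) (PV i).1).
split; first exact: smooth_fun_congr oO E (smooth_fun_sum r oO sfg).
refine (etrans (esym (dfun_congr oO Oq (X q) E)) _).
refine (etrans (dfun_sum r (X q) oO Oq sfg) _).
have cE := cov_sum hM hnab r X oO Oq sf sV.
have lhs i : dfun (fun q' => f i q' *: g (iota q') (V i q') (W q')) q (X q)
   = dfun (f i) q (X q) * g (iota q) (V i q) (W q)
     + f i q * g (iota q) (D X (V i) q) (W q)
     + f i q * g (iota q) (V i q) (D X W q).
  refine (etrans (dfun_scale oO Oq (X q) (sf i) (PV i).1) _).
  refine (etrans (congr1 (fun x : R => _ + f i q *: x) (PV i).2) _).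
  by rewrite /GRing.scale /= mulrDr addrA.
refine (etrans (eq_bigr _ (fun i _ => lhs i)) _).
refine (etrans _ (congr1 (fun u => g (iota q) u (W q) + _) (esym cE))).
rewrite big_split /=; congr (_ + _); last by rewrite metric_suml.
rewrite big_split /= [\sum_(i <- r) (_ *: _ + _ *: _)]big_split /=.
rewrite -[X in g _ (X + _)]scale1r (metric_linear hg) mul1r !metric_suml //.
Qed.

Lemma product_rule_restrict (A : set B) O X q (V W : vfield B) : open A ->
  O `<=` iota @^-1` A -> open O -> O q -> smooth_vf A V -> smooth_vf A W ->
  product_rule O X q (V \o iota) (W \o iota).
Proof.
move=> oA OA oO Oq sV sW; have Aq := OA q Oq.
have sg := metric_smooth hg oA sV sW; split.
  exact: smooth_fun_sub OA (smooth_pull hM oA sg).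
refine (etrans (dfun_pull hM (X q) oA sg Aq) _).
set b := iota q; set w := dmap _ _ _.
have sub : A `&` dom b `<=` A by move=> ? [].
have sub' : A `&` dom b `<=` dom b by move=> ? [].
have sw := smooth_vf_sub sub' (@smooth_const_field _ _ B b w).
have iq : (A `&` dom b) b by split=> //; exact: dom_center.
have := lc_metric hLC (openID b oA) sw (smooth_vf_sub sub sV) (smooth_vf_sub sub sW) iq.
rewrite const_field_center => ->.
refine (congr2 (fun x y : R => x + y)
  (congr1 (fun u => g _ u _) _) (congr1 (fun u => g _ _ u) _)).
  exact: esym (cov_restrict hM hnab X oA Aq sV).
exact: esym (cov_restrict hM hnab X oA Aq sW).
Qed.

Lemma product_rule_congr O X q V V' W : open O -> O q ->
  (forall q', O q' -> V q' = V' q') -> product_rule O X q V W -> product_rule O X q V' W.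
Proof.
move=> oO Oq VV [sVW E].
have VV' q' : O q' -> g (iota q') (V q') (W q') = g (iota q') (V' q') (W q').
  by move=> Oq'; rewrite VV.
split; first exact: smooth_fun_congr oO VV' sVW.
refine (etrans (esym (dfun_congr oO Oq (X q) VV')) (etrans E _)).
by rewrite (cov_congr X oO Oq VV) (VV q Oq).
Qed.

(** The rule holds for restrictions of ambient fields by compatibility of nab with
    g. It extends to arbitrary fields along iota by expanding first one argument
    and then the other in coordinate fields. *)
Lemma cov_product_local b O X q V W : open O -> O q -> O `<=` iota @^-1` dom b ->
  smooth_along (iota := iota) O V -> smooth_along (iota := iota) O W ->
  product_rule O X q V W.
Proof.
move=> oO Oq Ob sV sW; have db := dom_open b.
pose dj (j : 'I_N) := const_field b (e_ j).
have sd j : smooth_vf (dom b) (dj j) by exact: smooth_const_field.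
have sa j : smooth_along (iota := iota) O (dj j \o iota).
  exact: smooth_along_sub Ob (smooth_along_restrict hM db (sd j)).
have expand U q' : O q' -> \sum_j acomp (iota := iota) b U q' j *: dj j (iota q') = U q'.
  by move=> /Ob bq'; exact: esym (acomp_expand U bq').
have step U U' : smooth_along (iota := iota) O U ->
    (forall j, product_rule O X q (dj j \o iota) U') -> product_rule O X q U U'.
  move=> sU PU; apply: (product_rule_congr oO Oq (expand U)).
  exact: (product_rule_sum _ oO Oq (fun j => smooth_acomp j oO sU Ob) sa PU).
apply: (step V W sV) => j; apply: (product_rule_sym oO Oq).
by apply: (step W _ sW) => i; exact: (product_rule_restrict X db Ob oO Oq (sd i) (sd j)).
Qed.

Lemma smooth_metric_along O V W : open O -> smooth_along (iota := iota) O V ->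
  smooth_along (iota := iota) O W -> smooth_fun O (fun q => g (iota q) (V q) (W q)).
Proof.
move=> oO sV sW; apply: smooth_fun_local => q Oq.
pose Q := O `&` iota @^-1` dom (iota q); have oQ : open Q := openIpre hM (iota q) oO.
have QO : Q `<=` O by move=> ? [].
have Qb : Q `<=` iota @^-1` dom (iota q) by move=> ? [].
have Qq : Q q by split=> //; exact: dom_center.
exists Q; split=> //.
have sV' := smooth_along_sub QO sV; have sW' := smooth_along_sub QO sW.
exact: (cov_product_local (fun=> 0) oQ Qq Qb sV' sW').1.
Qed.

Lemma cov_product O X q V W : open O -> O q -> smooth_along (iota := iota) O V ->
  smooth_along (iota := iota) O W ->
  dfun (fun q => g (iota q) (V q) (W q)) q (X q)
  = g (iota q) (D X V q) (W q) + g (iota q) (V q) (D X W q).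
Proof.
move=> oO Oq sV sW.
pose Q := O `&` iota @^-1` dom (iota q); have oQ : open Q := openIpre hM (iota q) oO.
have QO : Q `<=` O by move=> ? [].
have Qb : Q `<=` iota @^-1` dom (iota q) by move=> ? [].
have Qq : Q q by split=> //; exact: dom_center.
exact: (cov_product_local X oQ Qq Qb (smooth_along_sub QO sV) (smooth_along_sub QO sW)).2.
Qed.

Lemma lin_row (f : 'rV[R]_N -> 'rV[R]_N) u :
  (forall a u v, f (a *: u + v) = a *: f u + f v) -> f u = \sum_j u 0 j *: f (e_ j).
Proof.
move=> lf; have f0 : f 0 = 0.
  have := lf 1 0 0; rewrite !scale1r addr0 => /eqP.
  by rewrite -subr_eq subrr eq_sym => /eqP.
rewrite {1}(row_sum_delta u); elim: (index_enum _) => [|j r IH]; first by rewrite !big_nil.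
by rewrite !big_cons lf IH.
Qed.

(** The curvature of nab is only available on ambient fields. Expanding V and
    the two directions in the coordinate fields of one chart reduces the
    commutator to the curvature of nab on coordinate fields, whose brackets
    vanish; trilinearity of Rt reassembles the components. *)
Lemma cov_curvature O X Y V q (Rt : 'rV[R]_N -> 'rV[R]_N -> 'rV[R]_N -> 'rV[R]_N) :
  open O -> O q -> smooth_vf O X -> smooth_vf O Y -> smooth_along (iota := iota) O V ->
  (forall y z a u v, Rt (a *: u + v) y z = a *: Rt u y z + Rt v y z) ->
  (forall x z a u v, Rt x (a *: u + v) z = a *: Rt x u z + Rt x v z) ->
  (forall x y a u v, Rt x y (a *: u + v) = a *: Rt x y u + Rt x y v) ->
  (forall u v w, curv nab (const_field (iota q) u) (const_field (iota q) v)
     (const_field (iota q) w) (iota q) = Rt u v w) ->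
  D X (D Y V) q - D Y (D X V) q - D (lie X Y) V q
  = Rt (dmap iota q (X q)) (dmap iota q (Y q)) (V q).
Proof.
move=> oO Oq sX sY sV lR1 lR2 lR3 cR; set b := iota q in cR *.
have bb := dom_center b; have db := dom_open b.
pose Q := O `&` iota @^-1` dom b; have oQ : open Q := openIpre hM b oO.
have Qq : Q q by [].
have QO : Q `<=` O by move=> ? [].
have Qb : Q `<=` iota @^-1` dom b by move=> ? [].
have {oO sX} sX := smooth_vf_sub QO sX; have {}sY := smooth_vf_sub QO sY.
have {}sV := smooth_along_sub QO sV.
pose d (j : 'I_N) := const_field b (e_ j); pose G i j := nab (d i) (d j).
have sd j : smooth_vf (dom b) (d j) by exact: smooth_const_field.
have sG i j : smooth_vf (dom b) (G i j) := conn_smooth hnab db (sd i) (sd j).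
have sa (W : vfield B) : smooth_vf (dom b) W -> smooth_along (iota := iota) Q (W \o iota).
  by move=> sW; exact: smooth_along_sub Qb (smooth_along_restrict hM db sW).
pose v j q' := acomp (iota := iota) b V q' j.
pose c Z i q' := acomp (iota := iota) b (push Z) q' i.
have sv j : smooth_fun Q (v j) := smooth_acomp j oQ sV Qb.
have sc Z i : smooth_vf Q Z -> smooth_fun Q (c Z i).
  by move=> sZ; exact: (smooth_acomp i oQ (smooth_along_dmap hM oQ sZ) Qb).
(* S1 and S2 combine restrictions of ambient fields, so that the Leibniz rule
   differentiates each of them once more. *)
have second A Z : smooth_vf Q A -> smooth_vf Q Z -> D A (D Z V) q =
    \sum_j (dfun (fun q' => dfun (v j) q' (Z q')) q (A q) *: d j b
       + dfun (v j) q (Z q) *: \sum_i c A i q *: G i j b)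
    + \sum_j \sum_i ((dfun (v j) q (A q) * c Z i q + v j q * dfun (c Z i) q (A q))
           *: G i j b + (v j q * c Z i q) *: \sum_a c A a q *: nab (d a) (G i j) b).
  move=> sA sZ; have sdv j : smooth_fun Q (fun q' => dfun (v j) q' (Z q')).
    exact: (smooth_dfun oQ (sv j) sZ).
  pose h (p : 'I_N * 'I_N) q' := v p.1 q' *: c Z p.2 q'.
  have sh p : smooth_fun Q (h p) := smooth_fun_scale oQ (sv p.1) (sc Z p.2 sZ).
  pose S1 q' := \sum_j dfun (v j) q' (Z q') *: (d j \o iota) q'.
  pose S2 q' := \sum_p h p q' *: (G p.2 p.1 \o iota) q'.
  have sS1 : smooth_along (iota := iota) Q S1.
    apply: (smooth_along_sum hM _ oQ) => j.
    exact: (smooth_along_scale hM oQ (sdv j) (sa _ (sd j))).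
  have sS2 : smooth_along (iota := iota) Q S2.
    apply: (smooth_along_sum hM _ oQ) => p.
    exact: (smooth_along_scale hM oQ (sh p) (sa _ (sG p.2 p.1))).
  have E q' : Q q' -> D Z V q' = S1 q' + S2 q'.
    move=> Qq'; refine (etrans (cov_chart hM hnab Z oQ Qq' Qb sV) _).
    rewrite big_split /=; congr (_ + _).
    rewrite /S2 -(pair_bigA _ (fun j i => h (j, i) q' *: (G i j \o iota) q')) /=.
    apply: eq_bigr => j _; rewrite scaler_sumr; apply: eq_bigr => i _.
    by rewrite scalerA.
  refine (etrans (cov_congr A oQ Qq E) _).
  refine (etrans (cov_add hM hnab A oQ Qq sS1 sS2) _).
  have nE (W : vfield B) : smooth_vf (dom b) W ->
      D A (W \o iota) q = \sum_a c A a q *: nab (d a) W b.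
    move=> sW; refine (etrans (cov_restrict hM hnab A db bb sW) _).
    exact: (nabv_expand hnab _ db bb bb sW).
  congr (_ + _).
    refine (etrans (cov_sum hM hnab _ A oQ Qq sdv (fun j => sa _ (sd j))) _).
    apply: eq_bigr => j _; congr (_ + _ *: _); exact: nE.
  refine (etrans (cov_sum hM hnab _ A oQ Qq sh (fun p => sa _ (sG p.2 p.1))) _).
  rewrite pair_bigA; apply: eq_bigr => -[j i] _ /=.
  congr (_ *: _ + _ *: _); last exact: nE.
  exact: (dfun_scale oQ Qq (A q) (sv j) (sc Z i sZ)).
have third : D (lie X Y) V q = \sum_j (dfun (v j) q (lie X Y q) *: d j b
    + v j q *: \sum_i c (lie X Y) i q *: G i j b).
  exact: (cov_chart hM hnab (lie X Y) oQ Qq Qb sV).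
rewrite (second X Y sX sY) (second Y X sY sX) third.
have sF : smooth_fun Q (chart b \o iota) := smooth_fun_sub Qb (submfd_smooth hM b).
pose F i q' := (chart b \o iota) q' 0 i.
have sFi i : smooth_fun Q (F i) := smooth_fun_coord i oQ sF.
have cF Z i q' : Q q' -> c Z i q' = dfun (F i) q' (Z q').
  move=> Qq'; refine (etrans (congr1 (fun u : 'rV[R]_N => u 0 i)
    (dfun_chart_dmap hM (Z q') (Qb q' Qq'))) _).
  exact: (dfun_coord (Z q') i oQ Qq' sF).
have cLie i : dfun (c Y i) q (X q) - dfun (c X i) q (Y q) = c (lie X Y) i q.
  have cE Z Z' : dfun (c Z i) q (Z' q) = dfun (fun q' => dfun (F i) q' (Z q')) q (Z' q).
    by apply: (dfun_congr oQ Qq) => q' Qq'; exact: cF.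
  refine (etrans (congr2 (fun x y : R => x - y) (cE Y X) (cE X Y)) _).
  exact: (etrans (dfun_lie oQ Qq (sFi i) sX sY) (esym (cF _ i q Qq))).
have vLie j := dfun_lie oQ Qq (sv j) sX sY.
refine (etrans (curvature_bookkeeping (fun j => d j b) (fun i j => G i j b)
  (fun a i j => nab (d a) (G i j) b) (fun j => v j q) _ _ (fun i => c X i q)
  (fun i => c Y i q) vLie cLie) _).
have cR' a i j : nab (d a) (G i j) b - nab (d i) (G a j) b = Rt (e_ a) (e_ i) (e_ j).
  have s0 := smooth_vf0 (M := B) db.
  have lie0 : nab (lie (d a) (d i)) (d j) b = 0.
    refine (etrans _ (conn0l hnab db (sd j) bb)).
    apply: esym; apply: (conn_local hnab db s0 (sd j)) => // r br.
    exact: esym (lie_const_field _ _ br).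
  have subE (u w : 'rV[R]_N) : w = 0 -> u = u - w by move=> ->; rewrite subr0.
  exact: etrans (subE _ _ lie0) (cR (e_ a) (e_ i) (e_ j)).
rewrite (lin_row (V q) (lR3 _ _)); apply: eq_bigr => j _.
rewrite (lin_row (dmap iota q (Y q)) (lR2 _ _)) scaler_sumr; apply: eq_bigr => i _.
rewrite (lin_row (dmap iota q (X q)) (lR1 _ _)) !scaler_sumr; apply: eq_bigr => a _.
rewrite !scalerA; refine (congr2 (fun (x : R) (u : 'rV[R]_N) => x *: u) _ (cR' a i j)).
have cq Z l : c Z l q = dmap iota q (Z q) 0 l by rewrite /c /acomp dfun_chart_id.
by rewrite !cq /v /acomp dfun_chart_id.
Qed.

End AlongCurvature.

(** * Skew operators on a Euclidean space *)

Section EuclideanSpace.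
Context {R : realType} {n : nat} {b : 'rV[R]_n -> 'rV[R]_n -> R}.
Hypothesis bl : forall a u v w, b (a *: u + v) w = a * b u w + b v w.
Hypothesis bs : forall u v, b u v = b v u.
Hypothesis bp : forall v, v != 0 -> 0 < b v v.
Implicit Types (u v w : 'rV[R]_n) (S : {vspace 'rV[R]_n}).

Lemma ip0l w : b 0 w = 0.
Proof.
have := bl 1 0 0 w; rewrite scale1r addr0 mul1r => /eqP.
by rewrite -subr_eq subrr eq_sym => /eqP.
Qed.

Lemma ipDl u v w : b (u + v) w = b u w + b v w.
Proof. by rewrite -[u]scale1r bl mul1r scale1r. Qed.

Lemma ipZl a u w : b (a *: u) w = a * b u w.
Proof. by rewrite -[a *: u]addr0 bl ip0l addr0. Qed.

Lemma ipBl u v w : b (u - v) w = b u w - b v w.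
Proof. by rewrite ipDl -scaleN1r ipZl mulN1r. Qed.

Lemma ipDr u v w : b w (u + v) = b w u + b w v.
Proof. by rewrite bs ipDl !(bs w). Qed.

Lemma ipZr a u w : b w (a *: u) = a * b w u.
Proof. by rewrite bs ipZl (bs w). Qed.

Lemma ip_suml (I : Type) (r : seq I) (P : pred I) (u : I -> 'rV[R]_n) w :
  b (\sum_(i <- r | P i) u i) w = \sum_(i <- r | P i) b (u i) w.
Proof. exact: (big_morph (b^~ w) (fun u v => ipDl u v w) (ip0l w)). Qed.

Lemma ip_ge0 v : 0 <= b v v.
Proof. by have [->|/bp/ltW//] := eqVneq v 0; rewrite ip0l. Qed.

Lemma ip_eq0 v : b v v = 0 -> v = 0.
Proof.
by move=> v0; apply/eqP; apply: contraT => /bp; rewrite v0 ltxx.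
Qed.

Lemma ip_inj u v : (forall w, b u w = b v w) -> u = v.
Proof.
move=> uv; apply/eqP; rewrite -subr_eq0; apply/eqP; apply: ip_eq0.
by rewrite ipBl uv subrr.
Qed.

(** The projection is specified by a choice operator; positivity of b makes the
    specification unique, so one decomposition identifies it. *)
Lemma orth_projP S u r : u \in S -> (forall w, w \in S -> b r w = 0) ->
  orth_proj b S (u + r) = u.
Proof.
move=> uS rS; rewrite /orth_proj; case: xgetP => [v _ [vS vr]|/(_ u)]; last first.
  by case; split=> // w wS; rewrite addrC addKr rS.
have dS : u - v \in S by rewrite rpredB.
apply/esym/eqP; rewrite -subr_eq0; apply/eqP; apply: ip_eq0.
by have := vr _ dS; rewrite addrAC ipDl rS // addr0.
Qed.

Section SkewOperator.
Context {T : 'rV[R]_n -> 'rV[R]_n} {xi : 'rV[R]_n} {l : nat} {lam : 'I_l -> R}.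
Context {S : R -> {vspace 'rV[R]_n}}.
Hypothesis Tskew : forall u v, b (T u) v = - b u (T v).
Hypothesis Txi : T xi = 0.
Hypothesis xi1 : b xi xi = 1.
Hypothesis lam01 : forall i, 0 < lam i < 1.
Hypothesis lam_inj : injective (fun i => - lam i ^+ 2).
Hypothesis SP : forall a v, v \in S a <-> b v xi = 0 /\ T (T v) = - a ^+ 2 *: v.
Hypothesis Sfull : (S 1 + S 0 + \sum_(i < l) S (lam i) + <[xi]>)%VS = fullv.

Let s := [:: 1, 0 & [seq lam i | i : 'I_l]].

(** T^2 is self-adjoint because T is skew. *)
Lemma eigen_orthogonal a c u v : a ^+ 2 != c ^+ 2 -> u \in S a -> v \in S c -> b u v = 0.
Proof.
move=> ac /SP[_ Tu] /SP[_ Tv].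
have : b (T (T u)) v = b u (T (T v)) by rewrite Tskew Tskew opprK.
rewrite Tu Tv ipZl ipZr => /eqP; rewrite -subr_eq0 -mulrBl mulf_eq0 => /orP[|/eqP//].
by rewrite opprK addrC subr_eq0 eq_sym (negbTE ac).
Qed.

Lemma lam_neq01 i : lam i ^+ 2 != 1 ^+ 2 /\ lam i ^+ 2 != 0 ^+ 2.
Proof.
have /andP[l0 l1] := lam01 i.
rewrite !(eqrXn2 (n := 2)) //; first by rewrite (lt_eqF l1) (gt_eqF l0).
all: exact: ltW.
Qed.

Lemma eigen_xi a v : v \in S a -> b xi v = 0.
Proof. by move=> /SP[vxi _]; rewrite bs. Qed.

Local Notation U a := (orth_proj b (S a)).

(** In the eigenspace decomposition of v, the component for a is its orthogonal
    projection, since all other components are orthogonal to that eigenspace. *)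
Lemma eigen_projections v :
  (forall a, a \in s -> U a v \in S a /\ forall w, w \in S a -> b (U a v) w = b v w)
  /\ v = \sum_(a <- s) U a v + b v xi *: xi.
Proof.
have : v \in fullv by rewrite memvf.
rewrite -Sfull => /memv_addP[x /memv_addP[y /memv_addP[v1 S1 [v0 S0 ->]]
  [z /memv_sumP[w Sw ->] ->]] [t /vlineP[c ->] Ev]].
have {}Sw i : w i \in S (lam i) by exact: Sw.
pose W := \sum_i w i.
have {}Ev : v = v1 + v0 + W + c *: xi by rewrite Ev.
have n10 : (1 : R) ^+ 2 != 0 ^+ 2 by rewrite expr1n expr0n oner_neq0.
have n01 : (0 : R) ^+ 2 != 1 ^+ 2 by rewrite eq_sym.
have WS a u : u \in S a -> (forall i, lam i ^+ 2 != a ^+ 2) -> b W u = 0.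
  move=> ua la; rewrite ip_suml big1 // => i _.
  exact: (eigen_orthogonal (la i) (Sw i) ua).
have xiS a u : u \in S a -> b (c *: xi) u = 0.
  by move=> ua; rewrite ipZl (eigen_xi ua) mulr0.
have U1 u : u \in S 1 -> b (v0 + W + c *: xi) u = 0.
  move=> uS; rewrite !ipDl (xiS _ _ uS) (eigen_orthogonal n01 S0 uS).
  by rewrite (WS _ _ uS (fun i => (lam_neq01 i).1)) !addr0.
have U0 u : u \in S 0 -> b (v1 + W + c *: xi) u = 0.
  move=> uS; rewrite !ipDl (xiS _ _ uS) (eigen_orthogonal n10 S1 uS).
  by rewrite (WS _ _ uS (fun i => (lam_neq01 i).2)) !addr0.
have Ui i u : u \in S (lam i) ->
    b (v1 + v0 + (\sum_(j | j != i) w j) + c *: xi) u = 0.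
  move=> uS; have [l1 l0] := lam_neq01 i; rewrite !ipDl (xiS _ _ uS).
  rewrite eq_sym in l1; rewrite eq_sym in l0.
  rewrite (eigen_orthogonal l1 S1 uS) (eigen_orthogonal l0 S0 uS) !add0r addr0.
  rewrite ip_suml big1 // => j ji.
  apply: (eigen_orthogonal _ (Sw j) uS); apply: contra ji => /eqP E.
  by apply/eqP/lam_inj; rewrite /= E.
have E1 : v = v1 + (v0 + W + c *: xi) by rewrite Ev !addrA.
have E0 : v = v0 + (v1 + W + c *: xi) by rewrite Ev !addrA (addrC v0).
have Ei i : v = w i + (v1 + v0 + (\sum_(j | j != i) w j) + c *: xi).
  rewrite Ev /W (bigD1 i) //= addrA [RHS]addrA; congr (_ + _).
  by rewrite !addrA; congr (_ + _); rewrite addrC addrA.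
have P1 : U 1 v = v1 by rewrite E1 orth_projP.
have P0 : U 0 v = v0 by rewrite E0 orth_projP.
have Pi i : U (lam i) v = w i by rewrite (Ei i) orth_projP // => u; exact: Ui.
have xic : b v xi = c.
  rewrite Ev !ipDl ipZl xi1 mulr1 (bs v1) (bs v0) (bs W).
  rewrite (eigen_xi S1) (eigen_xi S0) bs ip_suml big1 ?add0r // => i _.
  by rewrite bs (eigen_xi (Sw i)).
split.
  move=> a; rewrite !inE => /or3P[/eqP->|/eqP->|/mapP[i _ ->]].
  - by rewrite P1; split=> // u uS; rewrite E1 ipDl U1 // addr0.
  - by rewrite P0; split=> // u uS; rewrite E0 ipDl U0 // addr0.
  - by rewrite Pi; split=> // u uS; rewrite (Ei i) ipDl Ui // addr0.
rewrite !big_cons big_image /= P1 P0 xic {1}Ev /W addrA.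
by under [in RHS]eq_bigr do rewrite Pi.
Qed.

Lemma skew_linear a u v : T (a *: u + v) = a *: T u + T v.
Proof.
by apply: ip_inj => w; rewrite bl !Tskew bl opprD mulrN.
Qed.

Lemma ip_projection a v : a \in s -> b (U a v) v = b (U a v) (U a v).
Proof.
move=> /((eigen_projections v).1 a)[Sa Ea].
by rewrite (Ea _ Sa) bs.
Qed.

Lemma norm_decomposition v :
  b v v = \sum_(a <- s) b (U a v) (U a v) + b v xi ^+ 2.
Proof.
rewrite {1}(eigen_projections v).2 ipDl ipZl (bs xi) -expr2 ip_suml.
by congr (_ + _); apply: eq_big_seq => a; exact: ip_projection.
Qed.

Lemma skew0 : T 0 = 0.
Proof. by apply: ip_inj => w; rewrite Tskew !ip0l oppr0. Qed.

Lemma skewD u v : T (u + v) = T u + T v.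
Proof. by rewrite -[u]scale1r skew_linear !scale1r. Qed.

Lemma skewZ a u : T (a *: u) = a *: T u.
Proof. by rewrite -[a *: u]addr0 skew_linear skew0 addr0. Qed.

(** As T is skew, the squared norm of T v is the quadratic form of - T^2 at v, and
    - T^2 acts on the a-component as a ^+ 2. *)
Lemma norm_skew_image v :
  b (T v) (T v) = \sum_(a <- s) a ^+ 2 * b (U a v) (U a v).
Proof.
have TT : T (T v) = \sum_(a <- s) (- a ^+ 2) *: U a v.
  rewrite {1}(eigen_projections v).2 !skewD !skewZ Txi skew0 scaler0 addr0.
  rewrite !(big_morph T skewD skew0).
  apply: eq_big_seq => a /((eigen_projections v).1 a)[Sa _].
  by have /SP[] := Sa.
rewrite Tskew bs TT ip_suml -sumrN; apply: eq_big_seq => a sa.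
by rewrite ipZl mulNr opprK ip_projection.
Qed.

Lemma proj_linear c a u v : a \in s -> U a (c *: u + v) = c *: U a u + U a v.
Proof.
move=> sa; have H w := (eigen_projections w).1 a sa.
have [Suv Euv] := H (c *: u + v); have [Su Eu] := H u; have [Sv Ev] := H v.
apply/eqP; rewrite -subr_eq0; apply/eqP; apply: ip_eq0.
have Sd : U a (c *: u + v) - (c *: U a u + U a v) \in S a.
  by rewrite rpredB // rpredD // rpredZ.
by rewrite {1}ipBl Euv // !bl Eu // Ev // subrr.
Qed.

(** The left side is the trace of the projection, computed in an orthonormal
    basis; computed through a basis of the image, on which the projection is the
    identity, it counts the elements of that basis. *)
Lemma trace_projection (e : 'I_n -> 'rV[R]_n) a : a \in s ->
  (forall v, v = \sum_i b v (e i) *: e i) ->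
  \sum_i b (U a (e i)) (U a (e i)) = (\dim (S a))%:R.
Proof.
move=> sa He; have H w := (eigen_projections w).1 a sa.
have U0 : U a 0 = 0.
  by rewrite -[X in U a X](subrr 0) -scaleN1r addrC proj_linear // scaleN1r addNr.
have UD u v : U a (u + v) = U a u + U a v.
  by rewrite -[u]scale1r proj_linear // !scale1r.
have UZ c u : U a (c *: u) = c *: U a u.
  by rewrite -[c *: u]addr0 proj_linear // U0 addr0.
have Uid w : w \in S a -> U a w = w.
  by move=> Sw; rewrite -[w in LHS]addr0 orth_projP // => u _; rewrite ip0l.
pose X := vbasis (S a).
transitivity (\sum_i \sum_(k < \dim (S a)) coord X k (U a (e i)) * b X`_k (e i)).
  apply: eq_bigr => i _; rewrite -ip_projection //.
  rewrite {1}(coord_vbasis (H (e i)).1) ip_suml.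
  by apply: eq_bigr => k _; rewrite ipZl.
rewrite exchange_big /=.
transitivity (\sum_(k < \dim (S a)) (1 : R)); last by rewrite sumr_const card_ord.
apply: eq_bigr => k _.
have XS : X`_k \in S a by rewrite vbasis_mem // mem_nth // size_tuple.
transitivity (coord X k (U a X`_k)); last first.
  by rewrite (Uid _ XS) coord_free ?eqxx //; exact: basis_free (vbasisP _).
rewrite {2}(He X`_k) (big_morph (orth_proj b (S a)) UD U0) linear_sum.
by apply: eq_bigr => i _; rewrite UZ linearZ mulrC.
Qed.

End SkewOperator.

(** The matrix with rows e i is invertible: a row vector in its kernel has
    vanishing coordinates by orthonormality. *)
Lemma orthonormal_expand (e : 'I_n -> 'rV[R]_n) :
  (forall i j, b (e i) (e j) = (i == j)%:R) -> forall v, v = \sum_i b v (e i) *: e i.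
Proof.
move=> oe v; pose P := \matrix_i e i.
have bP (c : 'rV[R]_n) i : b (c *m P) (e i) = c 0 i.
  rewrite mulmx_sum_row ip_suml (bigD1 i) //= ipZl rowK oe eqxx mulr1.
  rewrite big1 ?addr0 // => j ji; by rewrite ipZl rowK oe (negbTE ji) mulr0.
have uP : P \in unitmx.
  rewrite -row_free_unit; apply/row_freeP; exists (invmx P).
  apply: mulmxV; rewrite unitmxE unitfE; apply/det0P => -[c c0 cP].
  case/negP: c0; apply/eqP/rowP => i; rewrite -bP cP ip0l mxE //.
rewrite -[v in LHS](mulmxKV uP) mulmx_sum_row; apply: eq_bigr => i _.
by rewrite rowK -[in RHS](mulmxKV uP v) bP.
Qed.

Lemma parseval (e : 'I_n -> 'rV[R]_n) u v : (forall i j, b (e i) (e j) = (i == j)%:R) ->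
  b u v = \sum_i b u (e i) * b v (e i).
Proof.
move=> oe; rewrite {1}(orthonormal_expand oe u) ip_suml.
by apply: eq_bigr => i _; rewrite ipZl (bs v).
Qed.

End EuclideanSpace.

(** * The induced metric and tangential parts *)

Section InducedMetric.
Context {R : realType} {N k : nat} {B : manifold R N} {M : manifold R k}.
Context {iota : M -> B} (hM : is_submanifold iota).
Context {g : B -> 'rV[R]_N -> 'rV[R]_N -> R} (hg : is_metric g).
Implicit Types (q : M) (u v : 'rV[R]_k).

Lemma dmap0 q : dmap iota q 0 = 0.
Proof.
have := dmap_linear hM q 1 0 0; rewrite !scale1r addr0 => /eqP.
by rewrite -subr_eq subrr eq_sym => /eqP.
Qed.

Lemma dmapD q u v : dmap iota q (u + v) = dmap iota q u + dmap iota q v.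
Proof. by have := dmap_linear hM q 1 u v; rewrite !scale1r. Qed.

Lemma dmapZ q a u : dmap iota q (a *: u) = a *: dmap iota q u.
Proof. by have := dmap_linear hM q a u 0; rewrite dmap0 !addr0. Qed.

Lemma dmapB q u v : dmap iota q (u - v) = dmap iota q u - dmap iota q v.
Proof. by rewrite -scaleN1r dmapD dmapZ scaleN1r. Qed.

Lemma ind_metric_linear q a u v w :
  ind_metric g iota q (a *: u + v) w = a * ind_metric g iota q u w + ind_metric g iota q v w.
Proof. by rewrite /ind_metric dmapD dmapZ (metric_linear hg). Qed.

Lemma ind_metric_sym q u v : ind_metric g iota q u v = ind_metric g iota q v u.
Proof. exact: (Defs.metric_sym hg). Qed.

Lemma ind_metric_pos q v : v != 0 -> 0 < ind_metric g iota q v v.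
Proof.
move=> v0; apply: (Defs.metric_pos hg); apply: contra v0 => /eqP v0.
by apply/eqP; apply: (submfd_immersion hM (p := q)); rewrite v0 dmap0.
Qed.

Section TangentialPart.
Context {p : M} {e : 'I_k -> 'rV[R]_k}.
Hypothesis oe : forall i j, ind_metric g iota p (e i) (e j) = (i == j)%:R.
Let gl := metric_linear hg (iota p).
Let gs := Defs.metric_sym hg (iota p).
Let expand := orthonormal_expand (ind_metric_linear p) oe.

(** The tangential part is chosen among the vectors that satisfy its defining
    property; an orthonormal basis shows that there is one. *)
Lemma tan_partP w u :
  g (iota p) (dmap iota p (tan_part g iota p w)) (dmap iota p u)
  = g (iota p) w (dmap iota p u).
Proof.
have sub v : g (iota p) (w - dmap iota p v) (dmap iota p u) = 0 ->
    g (iota p) (dmap iota p v) (dmap iota p u) = g (iota p) w (dmap iota p u).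
  by rewrite (ipBl gl) => /eqP; rewrite subr_eq0 => /eqP.
apply: sub; rewrite /tan_part; case: xgetP => [v _ ->//|H].
pose v0 := \sum_i g (iota p) w (dmap iota p (e i)) *: e i.
case: (H v0) => x /=; rewrite (ipBl gl) (gs (dmap iota p v0)).
rewrite -/(ind_metric g iota p x v0) [in X in X - _](expand x).
rewrite (big_morph _ (dmapD p) (dmap0 p)) (gs w) (ip_suml gl).
rewrite ind_metric_sym (ip_suml (ind_metric_linear p)) -sumrB big1 // => i _.
rewrite dmapZ (ipZl gl) (ipZl (ind_metric_linear p)) (gs _ w) (ind_metric_sym _ (e i)).
by rewrite mulrC subrr.
Qed.

(** In a smooth orthonormal frame this shows that tangential parts of smooth
    fields are smooth, with no need to invert a Gram matrix. *)
Lemma tan_part_frame w :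
  tan_part g iota p w = \sum_i g (iota p) w (dmap iota p (e i)) *: e i.
Proof.
rewrite [LHS]expand; apply: eq_bigr => i _; congr (_ *: _); exact: tan_partP.
Qed.

Lemma nor_part_perp w u : g (iota p) (nor_part g iota p w) (dmap iota p u) = 0.
Proof. by rewrite /nor_part (ipBl gl) tan_partP subrr. Qed.

Lemma tan_part_dmap v : tan_part g iota p (dmap iota p v) = v.
Proof.
apply: (ip_inj (ind_metric_linear p) (@ind_metric_pos p)) => u; exact: tan_partP.
Qed.

End TangentialPart.
End InducedMetric.

(** * The Gauss equation of the semisymmetric connection *)

Section Gauss.
Context {R : realType} {N k : nat} {B : manifold R N} {M : manifold R k}.
Context {iota : M -> B} (hM : is_submanifold iota).
Context {g : B -> 'rV[R]_N -> 'rV[R]_N -> R} (hg : is_metric g).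
Context {nab : vfield B -> vfield B -> vfield B} (hLC : is_levi_civita g nab).
Context {xi : vfield B} (sxi : smooth_vf setT xi) (txi : xi_tangent xi iota).
Context {eta : B -> 'rV[R]_N -> R} (hgxi : forall p v, g p v (xi p) = eta p v).
Context {U : set M} {E : 'I_k -> vfield M} (oU : open U).
Hypothesis sE : forall i, smooth_vf U (E i).
Hypothesis oE : forall p, U p -> forall i j,
  ind_metric g iota p (E i p) (E j p) = (i == j)%:R.
Implicit Types (q p : M) (X Y Z W A C : vfield M) (V : M -> 'rV[R]_N).
Let hnab := lc_connection hLC.
Let gl := fun q : M => metric_linear hg (iota q).
Let gs := fun q : M => Defs.metric_sym hg (iota q).
Local Notation nab' := (semisym eta nab).
Local Notation D := (cov_along nab iota).
Local Notation D' := (cov_along nab' iota).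
Local Notation N' := (ind_conn g nab' iota).
Local Notation h := (second_ff g nab' iota).
Local Notation push X := (fun q => dmap iota q (X q)).
Local Notation sm := (smooth_along (iota := iota)).

Lemma cov_semisym A V q :
  D' A V q = D A V q + eta (iota q) (V q) *: dmap iota q (A q).
Proof.
by rewrite /cov_along {1}/semisym !const_field_center addrA.
Qed.

Lemma smooth_xi : sm U (xi \o iota).
Proof.
by apply: smooth_along_sub (smooth_along_restrict hM openT sxi) => q _.
Qed.

Lemma smooth_eta V : sm U V -> smooth_fun U (fun q => eta (iota q) (V q)).
Proof.
move=> sV; apply: smooth_fun_congr oU _ (smooth_metric_along hM hg hLC oU sV smooth_xi).
by move=> q _; exact: hgxi.
Qed.

Lemma dfun_eta A V q : U q -> sm U V ->
  dfun (fun q => eta (iota q) (V q)) q (A q)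
  = eta (iota q) (D A V q) + g (iota q) (V q) (D A (xi \o iota) q).
Proof.
move=> Uq sV; rewrite -hgxi -(cov_product hM hg hLC A oU Uq sV smooth_xi).
by apply: (dfun_congr oU Uq) => q' _; rewrite -hgxi.
Qed.

Lemma smooth_cov' A V : smooth_vf U A -> sm U V -> sm U (D' A V).
Proof.
move=> sA sV.
have s1 := smooth_cov hM hnab oU sA sV.
have s2 := smooth_along_scale hM oU (smooth_eta sV) (smooth_along_dmap hM oU sA).
apply: smooth_along_congr (smooth_along_add hM oU s1 s2) => // q _.
exact: esym (cov_semisym A V q).
Qed.

Lemma h_perp A C q u : U q -> g (iota q) (h A C q) (dmap iota q u) = 0.
Proof. by move=> Uq; exact: (nor_part_perp hM hg (oE Uq)). Qed.

Lemma gauss_formula A C q : D' A (push C) q = dmap iota q (N' A C q) + h A C q.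
Proof. by rewrite /second_ff /nor_part /ind_conn addrC subrK. Qed.

Lemma smooth_push_ind_conn A C : smooth_vf U A -> smooth_vf U C ->
  sm U (push (N' A C)).
Proof.
move=> sA sC; have s' := smooth_cov' sA (smooth_along_dmap hM oU sC).
have sEi i := smooth_along_dmap hM oU (sE i).
apply: (smooth_along_congr hM (V := fun q => \sum_i
  g (iota q) (D' A (push C) q) (dmap iota q (E i q)) *: dmap iota q (E i q)) oU).
  move=> q Uq; rewrite /ind_conn (tan_part_frame hM hg (oE Uq)).
  rewrite (big_morph _ (dmapD hM q) (dmap0 hM q)).
  by apply: eq_bigr => i _; rewrite (dmapZ hM).
apply: (smooth_along_sum hM _ oU) => i; apply: (smooth_along_scale hM oU _ (sEi i)).
exact: (smooth_metric_along hM hg hLC oU s' (sEi i)).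
Qed.

Lemma smooth_h A C : smooth_vf U A -> smooth_vf U C -> sm U (h A C).
Proof.
move=> sA sC; have s' := smooth_cov' sA (smooth_along_dmap hM oU sC).
have sN := smooth_along_scale hM oU (smooth_fun_cst U (-1 : R)) (smooth_push_ind_conn sA sC).
apply: smooth_along_congr (smooth_along_add hM oU s' sN) => // q _.
by rewrite scaleN1r.
Qed.

Lemma ind_connP A C q u : U q ->
  g (iota q) (dmap iota q (N' A C q)) (dmap iota q u)
  = g (iota q) (D' A (push C) q) (dmap iota q u).
Proof. by move=> Uq; exact: (tan_partP hM hg (oE Uq)). Qed.

(** Differentiate the vanishing inner product of the normal field h C Z with the
    tangent field W. *)
Lemma weingarten A C Z q W : U q -> smooth_vf U A -> smooth_vf U C ->
  smooth_vf U Z -> smooth_vf U W ->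
  g (iota q) (D A (h C Z) q) (dmap iota q (W q)) = - g (iota q) (h C Z q) (h A W q).
Proof.
move=> Uq sA sC sZ sW.
have sW' := smooth_along_dmap hM oU sW.
have H := cov_product hM hg hLC A oU Uq (smooth_h sC sZ) sW'.
have move_r (d r n m : 'rV[R]_N) : d + r = n + m -> d = n - r + m.
  by move=> drnm; rewrite addrAC -drnm addrK.
have H0 : dfun (fun q => g (iota q) (h C Z q) (dmap iota q (W q))) q (A q) = 0.
  refine (etrans (dfun_congr oU Uq _ _) (dfun_cst (0 : R) (A q))) => q' Uq'.
  exact: h_perp.
have E2 : g (iota q) (h C Z q) (D A (push W) q) = g (iota q) (h C Z q) (h A W q).
  have := gauss_formula A W q; rewrite cov_semisym => F.
  have DW : D A (push W) q
      = dmap iota q (N' A W q - eta (iota q) (dmap iota q (W q)) *: A q) + h A W q.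
    refine (etrans (move_r _ _ _ _ F) (congr1 (fun u => u + h A W q) _)).
    by rewrite (dmapD hM) -!scaleNr (dmapZ hM).
  refine (etrans (congr1 (g (iota q) _) DW) (etrans (ipDr (gl q) (gs q) _ _ _) _)).
  exact: etrans (congr1 (fun x : R => x + _) (h_perp _ _ _ Uq)) (add0r _).
have oppE (x y z : R) : 0 = x + y -> y = z -> x = - z.
  by move=> xy <-; apply/eqP; rewrite -addr_eq0 -xy.
exact: oppE (etrans (esym H0) H) E2.
Qed.

(** The tangential part of the second derivative: writing the inner tangent
    derivative as an ambient one minus h, the ambient one is differentiated by
    the Leibniz rule and h by the Weingarten formula. *)
Lemma gauss_term A C Z W p : U p -> smooth_vf U A -> smooth_vf U C ->
  smooth_vf U Z -> smooth_vf U W ->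
  g (iota p) (dmap iota p (N' A (N' C Z) p)) (dmap iota p (W p))
  = g (iota p) (D A (D C (push Z)) p) (dmap iota p (W p))
    + (eta (iota p) (D A (push Z) p)
       + g (iota p) (dmap iota p (Z p)) (D A (xi \o iota) p))
      * g (iota p) (dmap iota p (C p)) (dmap iota p (W p))
    + eta (iota p) (dmap iota p (Z p))
      * g (iota p) (D A (push C) p) (dmap iota p (W p))
    + (eta (iota p) (D C (push Z) p)
       + eta (iota p) (dmap iota p (Z p)) * eta (iota p) (dmap iota p (C p)))
      * g (iota p) (dmap iota p (A p)) (dmap iota p (W p))
    + g (iota p) (h C Z p) (h A W p).
Proof.
move=> Up sA sC sZ sW.
have sZ' := smooth_along_dmap hM oU sZ; have sC' := smooth_along_dmap hM oU sC.
have sN := smooth_push_ind_conn sC sZ; have sh := smooth_h sC sZ.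
have etaN : eta (iota p) (dmap iota p (N' C Z p)) = eta (iota p) (D C (push Z) p)
    + eta (iota p) (dmap iota p (Z p)) * eta (iota p) (dmap iota p (C p)).
  have [x xE] := txi p.
  refine (etrans (esym (hgxi _ _)) _); rewrite -xE.
  refine (etrans (ind_connP _ _ _ Up) _).
  refine (etrans (congr1 (fun u => g (iota p) u _) (cov_semisym _ _ _)) _).
  refine (etrans (ipDl (gl p) _ _ _) (congr2 (fun x y : R => x + y) _ _)).
    by rewrite xE hgxi.
  by refine (etrans (ipZl (gl p) _ _ _) _); rewrite xE hgxi.
have E1 : D A (push (N' C Z)) p + D A (h C Z) p = D A (D C (push Z)) p
    + (dfun (fun q => eta (iota q) (dmap iota q (Z q))) p (A p) *: dmap iota p (C p)
       + eta (iota p) (dmap iota p (Z p)) *: D A (push C) p).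
  have sD := smooth_cov hM hnab oU sC sZ'.
  have sS := smooth_along_scale hM oU (smooth_eta sZ') sC'.
  refine (etrans (esym (cov_add hM hnab A oU Up sN sh)) _).
  refine (etrans (cov_congr A oU Up (fun q _ =>
    etrans (esym (gauss_formula C Z q)) (cov_semisym C (push Z) q))) _).
  refine (etrans (cov_add hM hnab A oU Up sD sS) (congr1 (fun u => _ + u) _)).
  exact: (cov_scale hM hnab A oU Up (smooth_eta sZ') sC').
have Wn := weingarten Up sA sC sZ sW.
(* Abstract scalars and vectors keep ring from looking into the derivatives. *)
have combine (n m d cv dc av w : 'rV[R]_N) (c c' z f f' K : R) :
    n + m = d + (c *: cv + z *: dc) -> c = c' -> f = f' -> g (iota p) m w = - K ->
    g (iota p) (n + f *: av) w = g (iota p) d w + c' * g (iota p) cv w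
      + z * g (iota p) dc w + f' * g (iota p) av w + K.
  move=> nm <- <- mK; have -> : n = d + (c *: cv + z *: dc) - m by rewrite -nm addrK.
  rewrite (ipDl (gl p)) (ipBl (gl p)) !(ipDl (gl p)) !(ipZl (gl p)) mK; ring.
refine (etrans (ind_connP _ _ _ Up) _).
refine (etrans (congr1 (fun u => g (iota p) u _) (cov_semisym _ _ _)) _).
exact: combine E1 (dfun_eta A Up sZ') etaN Wn.
Qed.

(** The difference is a normal vector. It is also tangent, because the torsion of
    the semisymmetric connection is: it is the bracket plus multiples of the two
    fields. *)
Lemma h_sym A C p : U p -> smooth_vf U A -> smooth_vf U C -> h A C p = h C A p.
Proof.
move=> Up sA sC.
have H : D' A (push C) p - D' C (push A) p
    = dmap iota p (lie A C p + (eta (iota p) (dmap iota p (C p)) *: A p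
                                - eta (iota p) (dmap iota p (A p)) *: C p)).
  rewrite !cov_semisym opprD addrACA (cov_torsion hM hLC oU Up sA sC).
  by rewrite !(dmapD hM) -!scaleNr !(dmapZ hM).
have transfer (n n' a a' t : 'rV[R]_N) : n + a - (n' + a') = t -> a - a' = t - (n - n').
  by move=> <-; rewrite opprD addrACA [RHS]addrAC subrr add0r.
rewrite !gauss_formula in H; have {}H := transfer _ _ _ _ _ H.
rewrite -!(dmapB hM) in H.
apply/eqP; rewrite -subr_eq0; apply/eqP.
apply: (ip_eq0 (@Defs.metric_pos _ _ _ _ hg (iota p))).
have perp u : g (iota p) (h A C p - h C A p) (dmap iota p u) = 0.
  refine (etrans (ipBl (gl p) _ _ _) (etrans (congr2 (fun x y : R => x - y)
    (h_perp _ _ _ Up) (h_perp _ _ _ Up)) (subrr _))).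
exact: etrans (congr1 (g (iota p) _) H) (perp _).
Qed.

(** Antisymmetrize the second derivative in X and Y and subtract the derivative
    along the bracket. The products of the second fundamental form are the usual
    Gauss terms; the terms in eta and in the derivative of xi form the difference
    of the curvatures of the semisymmetric and of the Levi-Civita connection. *)
Lemma gauss_equation X Y Z W p (Rt : 'rV[R]_N -> 'rV[R]_N -> 'rV[R]_N -> 'rV[R]_N) :
  U p -> smooth_vf U X -> smooth_vf U Y -> smooth_vf U Z -> smooth_vf U W ->
  (forall y z a u v, Rt (a *: u + v) y z = a *: Rt u y z + Rt v y z) ->
  (forall x z a u v, Rt x (a *: u + v) z = a *: Rt x u z + Rt x v z) ->
  (forall x y a u v, Rt x y (a *: u + v) = a *: Rt x y u + Rt x y v) ->
  (forall u v w, curv nab (const_field (iota p) u) (const_field (iota p) v)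
     (const_field (iota p) w) (iota p) = Rt u v w) ->
  riem g nab' iota X Y Z W p
  = g (iota p) (Rt (dmap iota p (X p)) (dmap iota p (Y p)) (dmap iota p (Z p)))
      (dmap iota p (W p))
    + g (iota p) (dmap iota p (Z p)) (D X (xi \o iota) p) * ind_metric g iota p (Y p) (W p)
    - g (iota p) (dmap iota p (Z p)) (D Y (xi \o iota) p) * ind_metric g iota p (X p) (W p)
    + eta (iota p) (dmap iota p (Z p))
      * (eta (iota p) (dmap iota p (Y p)) * ind_metric g iota p (X p) (W p)
         - eta (iota p) (dmap iota p (X p)) * ind_metric g iota p (Y p) (W p))
    + g (iota p) (h Y Z p) (h X W p) - g (iota p) (h X Z p) (h Y W p).
Proof.
move=> Up sX sY sZ sW l1 l2 l3 cR; rewrite /riem /ind_metric /curv.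
have sZ' := smooth_along_dmap hM oU sZ.
have K := cov_curvature hM hLC oU Up sX sY sZ' l1 l2 l3 cR.
have L : g (iota p) (dmap iota p (N' (lie X Y) Z p)) (dmap iota p (W p))
    = g (iota p) (D (lie X Y) (push Z) p) (dmap iota p (W p))
      + eta (iota p) (dmap iota p (Z p))
        * g (iota p) (dmap iota p (lie X Y p)) (dmap iota p (W p)).
  refine (etrans (ind_connP _ _ _ Up) _).
  refine (etrans (congr1 (fun u => g (iota p) u _) (cov_semisym _ _ _)) _).
  by rewrite (ipDl (gl p)) (ipZl (gl p)).
have T := cov_torsion hM hLC oU Up sX sY.
have GX := gauss_term Up sX sY sZ sW; have GY := gauss_term Up sY sX sZ sW.
have sub2 (u v w c : 'rV[R]_N) : g (iota p) (u - v - w) c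
    = g (iota p) u c - g (iota p) v c - g (iota p) w c by rewrite !(ipBl (gl p)).
have sub3 (u v w : 'rV[R]_k) c : g (iota p) (dmap iota p (u - v - w)) c
    = g (iota p) (dmap iota p u) c - g (iota p) (dmap iota p v) c
      - g (iota p) (dmap iota p w) c by rewrite !(dmapB hM) sub2.
have K' := etrans (esym (congr1 (fun u => g (iota p) u (dmap iota p (W p))) K)) (sub2 _ _ _ _).
have T' := etrans (esym (congr1 (fun u => g (iota p) u (dmap iota p (W p))) T))
  (ipBl (gl p) _ _ _).
have combine (a1 a2 a3 d1 d2 d3 e1 e2 z1 z2 gX gY eX eY ez t1 t2 t3 k1 k2 c : R) :
    a1 = d1 + (e1 + z1) * gY + ez * t1 + (e2 + ez * eY) * gX + k1 ->
    a2 = d2 + (e2 + z2) * gX + ez * t2 + (e1 + ez * eX) * gY + k2 ->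
    a3 = d3 + ez * t3 -> c = d1 - d2 - d3 -> t3 = t1 - t2 ->
    a1 - a2 - a3 = c + z1 * gY - z2 * gX + ez * (eY * gX - eX * gY) + k1 - k2.
  by move=> -> -> -> -> ->; ring.
exact: etrans (sub3 _ _ _ _) (combine _ _ _ _ _ _ _ _ _ _ _ _ _ _ _ _ _ _ _ _ _ GX GY L K' T').
Qed.

End Gauss.

(** * The Ricci curvature of a minimal submanifold *)

Lemma linfun_of_linear (R : fieldType) (V W : vectType R) (f : V -> W) v :
  linear f -> linfun f v = f v.
Proof.
move=> lf; pose fM := GRing.isLinear.Build _ _ _ _ _ lf.
pose F : {linear V -> W} := HB.pack f fM.
exact: (lfunE F v).
Qed.

Section GeneralizedSasakian.
Context {R : realType} {n m l : nat}.
Context {Mbar : manifold R n.*2.+1}.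
Context {phi : Mbar -> 'rV[R]_n.*2.+1 -> 'rV[R]_n.*2.+1} {xi : vfield Mbar}.
Context {eta : Mbar -> 'rV[R]_n.*2.+1 -> R}.
Context {g : Mbar -> 'rV[R]_n.*2.+1 -> 'rV[R]_n.*2.+1 -> R}.
Context {f1 f2 f3 : Mbar -> R} {nab : vfield Mbar -> vfield Mbar -> vfield Mbar}.
Hypothesis hMbar : gen_sasakian_space_form phi xi eta g f1 f2 f3 nab.
Context {M : manifold R m.+1} {iota : M -> Mbar} (hM : is_submanifold iota).
Hypothesis hxi : xi_tangent xi iota.
Context {U : set M} {E : 'I_m.+1 -> vfield M} (hU : open U).
Hypothesis hE : adapted_frame g xi iota U E.
Let acm := gssf_acm hMbar.
Let hg := acm_metric acm.
Let hLC := gssf_lc hMbar.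
Let oE := frame_orthonormal hE.
Let gl p := metric_linear hg p.
Let gs p := Defs.metric_sym hg p.
Let gr p a u v w : g p w (a *: u + v) = a * g p w u + g p w v.
Proof. by rewrite gs gl !(gs p w). Qed.
Let philin := acm_phi_linear acm.

Lemma acm_eta_linear p a u v : eta p (a *: u + v) = a * eta p u + eta p v.
Proof. by rewrite -!(acm_g_xi acm) gl. Qed.

Section Pointwise.
Context {p : M} (Up : U p).
Local Notation b := (ind_metric g iota p).
Local Notation T := (Tmap phi g iota p).
Local Notation xi' := (ind_xi g xi iota p).
Local Notation d := (dmap iota p).
Let bl := ind_metric_linear hM hg p.
Let bs := ind_metric_sym hg (iota := iota) p.
Let bp := @ind_metric_pos _ _ _ _ _ _ hM _ hg p.

Lemma dmap_xi : d xi' = xi (iota p).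
Proof.
have [v vE] := hxi p.
by rewrite /ind_xi -vE (tan_part_dmap hM hg (oE Up)).
Qed.

Lemma ind_eta_xi v : eta (iota p) (d v) = b v xi'.
Proof. by rewrite /ind_metric dmap_xi (acm_g_xi acm). Qed.

Lemma Tmap_form u v : b (T u) v = g (iota p) (phi (iota p) (d u)) (d v).
Proof. exact: (tan_partP hM hg (oE Up)). Qed.

Lemma Tmap_skew u v : b (T u) v = - b u (T v).
Proof.
refine (etrans (Tmap_form u v) (etrans (acm_phi_skew acm _ _ _) (congr1 -%R _))).
exact: etrans (gs _ _ _) (etrans (esym (Tmap_form v u)) (bs _ _)).
Qed.

Lemma Tmap_xi : T xi' = 0.
Proof.
apply: (ip_inj bl bp) => w.
by rewrite Tmap_form dmap_xi (acm_phi_xi acm) (ip0l (gl _)) (ip0l bl).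
Qed.

Lemma ind_xi1 : b xi' xi' = 1.
Proof. by rewrite -ind_eta_xi dmap_xi (acm_eta_xi acm). Qed.

Lemma Tmap_orth u : b (T u) u = 0.
Proof.
have := Tmap_skew u u; rewrite (bs u) => /eqP.
by rewrite -addr_eq0 -mulr2n mulrn_eq0 => /eqP.
Qed.

(** Both maps under linfun are linear, so linfun does not alter them. *)
Lemma mem_Deig a v :
  v \in Deig phi xi g iota p a <-> b v xi' = 0 /\ T (T v) = - a ^+ 2 *: v.
Proof.
have lb : linear (fun v : 'rV[R]_m.+1 => b v xi' : R^o) by move=> c u w; exact: bl.
have lT : linear (T \o T).
  have lT c u w := skew_linear bl bp Tmap_skew c u w.
  by move=> c u w /=; rewrite !lT.
rewrite /Deig memv_cap !memv_ker (linfun_of_linear _ lb).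
rewrite add_lfunE opp_lfunE scale_lfunE id_lfunE (linfun_of_linear _ lT) subr_eq0.
split=> [/andP[/eqP v1 /eqP v2]|[v1 v2]]; first by split.
by apply/andP; split; apply/eqP.
Qed.

Lemma sum_frame u v : \sum_i b u (E i p) * b v (E i p) = b u v.
Proof. exact: esym (parseval bl bs u v (oE Up)). Qed.

Lemma cov_xi (A : vfield M) :
  cov_along nab iota A (xi \o iota) p
  = - (f1 (iota p) - f3 (iota p)) *: phi (iota p) (d (A p)).
Proof.
have cp := dom_center (iota p); have od := dom_open (iota p).
have sxi := acm_xi_smooth acm.
refine (etrans (cov_restrict hM (lc_connection hLC) A openT I sxi) _).
have sc := @smooth_const_field _ _ Mbar (iota p) (d (A p)).
refine (etrans (gssf_nabla_xi hMbar od sc cp) _).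
by rewrite const_field_center.
Qed.

Local Notation Rt := (gssf_curvature phi xi eta g f1 f2 f3 (iota p)).

Lemma gssf_linear1 y z a u v : Rt (a *: u + v) y z = a *: Rt u y z + Rt v y z.
Proof.
rewrite /gssf_curvature philin !gl !acm_eta_linear.
by apply/rowP => j; rewrite !mxE; ring.
Qed.

Lemma gssf_linear2 x z a u v : Rt x (a *: u + v) z = a *: Rt x u z + Rt x v z.
Proof.
rewrite /gssf_curvature philin !gl !gr !acm_eta_linear.
by apply/rowP => j; rewrite !mxE; ring.
Qed.

Lemma gssf_linear3 x y a u v : Rt x y (a *: u + v) = a *: Rt x y u + Rt x y v.
Proof.
rewrite /gssf_curvature philin !acm_eta_linear !gr.
by apply/rowP => j; rewrite !mxE; ring.
Qed.

Lemma gssf_at_center u v w :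
  curv nab (const_field (iota p) u) (const_field (iota p) v)
    (const_field (iota p) w) (iota p) = Rt u v w.
Proof.
have cp := dom_center (iota p); have od := dom_open (iota p).
have sc := @smooth_const_field _ _ Mbar (iota p).
by rewrite (gssf_curv hMbar od (sc u) (sc v) (sc w) cp) !const_field_center.
Qed.

Local Notation nab' := (semisym eta nab).
Local Notation h := (second_ff g nab' iota).

(** The pairings with phi reduce to T, as they are taken against tangent vectors;
    since T is skew, the f2 part is three times a square. *)
Lemma gssf_sectional x e : b e e = 1 ->
  g (iota p) (Rt (d x) (d e) (d e)) (d x)
  = f1 (iota p) * (b x x - b x e * b x e)
    + 3 * f2 (iota p) * (b (T x) e * b (T x) e)
    + f3 (iota p) * (2 * b x xi' * (b xi' e * b x e)
                     - (b xi' e * b xi' e) * b x x - b x xi' * b x xi').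
Proof.
move=> e1.
have expand (F1 F2 F3 hx he c t : R) (y w fw fy z : 'rV[R]_n.*2.+1) :
    let G := g (iota p) in
    G w w = 1 -> G y w = c -> G w y = c -> G y fw = - t -> G w fw = 0 ->
    G fw y = - t -> G z y = hx ->
    G (F1 *: (G w w *: y - G y w *: w)
       + F2 *: (G y fw *: fw - G w fw *: fy + (2 * G y fw) *: fw)
       + F3 *: ((hx * he) *: w - (he * he) *: y + (G y w * he) *: z - (G w w * hx) *: z)) y
    = F1 * (G y y - c * c) + 3 * F2 * (t * t)
      + F3 * (2 * hx * (he * c) - (he * he) * G y y - hx * hx).
  move=> G w1 yw wy yf wf fy0 zy; rewrite w1 yw yf wf.
  have D u v : G (u + v) y = G u y + G v y := ipDl (gl _) u v y.
  have Z a u : G (a *: u) y = a * G u y := ipZl (gl _) a u y.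
  have N u : G (- u) y = - G u y by have := Z (-1) u; rewrite scaleN1r mulN1r.
  by rewrite !(D, N, Z) fy0 wy zy; ring.
have xE : g (iota p) (xi (iota p)) (d x) = eta (iota p) (d x).
  exact: etrans (gs _ _ _) (acm_g_xi acm _ _).
have tE : g (iota p) (phi (iota p) (d e)) (d x) = - b (T x) e.
  exact: etrans (esym (Tmap_form e x)) (etrans (Tmap_skew e x) (congr1 -%R (bs _ _))).
have t0 : g (iota p) (d e) (phi (iota p) (d e)) = 0.
  exact: etrans (gs _ _ _) (etrans (esym (Tmap_form e e)) (Tmap_orth e)).
refine (etrans (expand _ _ _ _ _ _ _ _ _ _ _ _ e1 erefl (gs _ _ _)
  (etrans (gs _ _ _) tE) t0 tE xE) _).
have he := etrans (ind_eta_xi e) (bs e xi').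
refine (congr2 (fun hx he : R => f1 (iota p) * _ + 3 * f2 (iota p) * _
  + f3 (iota p) * (2 * hx * (he * _) - (he * he) * _ - hx * hx)) _ he).
exact: ind_eta_xi.
Qed.

Lemma riem_frame X i : smooth_vf U X ->
  let c := b (X p) (E i p) in let t := b (T (X p)) (E i p) in
  let ei := b xi' (E i p) in let ex := b (X p) xi' in
  riem g nab' iota X (E i) (E i) X p
  = f1 (iota p) * (b (X p) (X p) - c * c) + 3 * f2 (iota p) * (t * t)
    + f3 (iota p) * (2 * ex * (ei * c) - (ei * ei) * b (X p) (X p) - ex * ex)
    - (f1 (iota p) - f3 (iota p)) * (t * c)
    + (ei * ei) * b (X p) (X p) - ex * (ei * c)
    + g (iota p) (h (E i) (E i) p) (h X X p)
    - g (iota p) (h X (E i) p) (h X (E i) p).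
Proof.
move=> sX c t ei ex; have sE := frame_smooth hE i.
have HG := gauss_equation hM hg hLC (acm_xi_smooth acm) hxi (acm_g_xi acm) hU
  (frame_smooth hE) oE Up sX sE sE sX gssf_linear1 gssf_linear2 gssf_linear3 gssf_at_center.
have hs := h_sym hM hg hLC (eta := eta) hU oE Up sE sX.
have cE : b (E i p) (X p) = c := bs _ _.
have e1 : b (E i p) (E i p) = 1 by rewrite (oE Up) eqxx.
have etaE : eta (iota p) (d (E i p)) = ei by refine (etrans (ind_eta_xi _) (bs _ _)).
have etaX : eta (iota p) (d (X p)) = ex := ind_eta_xi _.
have xiT A u : g (iota p) (d u) (cov_along nab iota A (xi \o iota) p)
    = - (f1 (iota p) - f3 (iota p)) * b (T (A p)) u.
  rewrite cov_xi; refine (etrans (ipZr (gl _) (gs _) _ _ _) (congr1 (fun x : R => _ * x) _)).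
  exact: etrans (gs _ _ _) (esym (Tmap_form _ _)).
have combine (K1 K2 K3 K4 F z1 z2 y1 eE eX x h1 h2 h2' : R) :
    K1 = K2 + K3 + K4 -> z1 = - F * t -> z2 = - F * 0 -> y1 = c -> eE = ei -> eX = ex ->
    h2 = h2' ->
    K1 + z1 * y1 - z2 * x + eE * (eE * x - eX * y1) + h1 - h2
    = K2 + K3 + K4 - F * (t * c) + ei * ei * x - ex * (ei * c) + h1 - h2'.
  by move=> -> -> -> -> -> -> ->; ring.
have e0 := etrans (xiT (E i) (E i p)) (congr1 (fun x : R => _ * x) (Tmap_orth (E i p))).
apply: (etrans HG); apply: combine (gssf_sectional _ e1) (xiT X (E i p)) e0 cE etaE etaX _.
exact: (congr1 (g (iota p) _) hs).
Qed.

(** Trace the Gauss equation over the frame. The mean curvature term vanishes by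
    minimality, the term in f1 - f3 because T is skew, and the remaining term in
    the second fundamental form is minus a sum of squares by symmetry. *)
Lemma ricci_le X : minimal g xi nab' iota -> smooth_vf U X ->
  ricci g nab' iota E X X p
  <= f1 (iota p) * (m%:R * b (X p) (X p)) + 3 * f2 (iota p) * b (T (X p)) (T (X p))
     + f3 (iota p) * ((1 - m%:R) * (b (X p) xi' * b (X p) xi') - b (X p) (X p))
     + b (X p) (X p) - b (X p) xi' * b (X p) xi'.
Proof.
move=> hmin sX.
have h0 : \sum_i h (E i) (E i) p = 0.
  have := hmin U E hU hE p Up; rewrite /mean_curv => /eqP.
  by rewrite scaler_eq0 invr_eq0 pnatr_eq0 /= => /eqP.
have hsum : \sum_i g (iota p) (h (E i) (E i) p) (h X X p) = 0.
  refine (etrans (esym (ip_suml (gl _) _ _ _ _)) _).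
  exact: etrans (congr1 (fun u => g (iota p) u _) h0) (ip0l (gl _) _).
have hpos : 0 <= \sum_i g (iota p) (h X (E i) p) (h X (E i) p).
  apply: sumr_ge0 => i _; exact: (ip_ge0 (gl _) (@Defs.metric_pos _ _ _ _ hg _)).
have Eee : \sum_i b xi' (E i p) * b xi' (E i p) = 1 := etrans (sum_frame _ _) ind_xi1.
have Eec : \sum_i b xi' (E i p) * b (X p) (E i p) = b (X p) xi'.
  exact: etrans (sum_frame _ _) (bs _ _).
have Etc : \sum_i b (T (X p)) (E i p) * b (X p) (E i p) = 0.
  exact: etrans (sum_frame _ _) (Tmap_orth _).
have sum (c t e h1 h2 : 'I_m.+1 -> R) (F1 F2 F3 F x2 t2 ex : R) :
    \sum_i c i * c i = x2 -> \sum_i t i * t i = t2 -> \sum_i e i * e i = 1 ->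
    \sum_i e i * c i = ex -> \sum_i t i * c i = 0 -> \sum_i h1 i = 0 ->
    \sum_i (F1 * (x2 - c i * c i) + 3 * F2 * (t i * t i)
      + F3 * (2 * ex * (e i * c i) - (e i * e i) * x2 - ex * ex)
      - F * (t i * c i) + (e i * e i) * x2 - ex * (e i * c i) + h1 i - h2 i)
    = F1 * (m%:R * x2) + 3 * F2 * t2 + F3 * ((1 - m%:R) * (ex * ex) - x2) + x2 - ex * ex
      - \sum_i h2 i.
  move=> cc tt ee ec tc hh.
  rewrite !(big_split, sumrN) /= -!mulr_sumr !(big_split, sumrN) /= -!mulr_sumr -!mulr_suml.
  by rewrite cc tt ee ec tc hh !sumr_const !card_ord; ring.
rewrite /ricci (eq_bigr _ (fun i _ => riem_frame i sX)).
rewrite (sum _ _ _ _ _ _ _ _ _ _ _ _ (sum_frame _ _) (sum_frame _ _) Eee Eec Etc hsum).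
by rewrite gerBl.
Qed.

End Pointwise.
End GeneralizedSasakian.

(** * The bounds on the Ricci and scalar curvatures *)

Theorem theorem4p1 (R : realType) (n m l : nat) (hn : (1 < n)%N)
    (hm : (1 <= m)%N)
    (Mbar : manifold R n.*2.+1)
    (phi : Mbar -> 'rV[R]_n.*2.+1 -> 'rV[R]_n.*2.+1) (xi : vfield Mbar)
    (eta : Mbar -> 'rV[R]_n.*2.+1 -> R)
    (g : Mbar -> 'rV[R]_n.*2.+1 -> 'rV[R]_n.*2.+1 -> R)
    (f1 f2 f3 : Mbar -> R) (nab : vfield Mbar -> vfield Mbar -> vfield Mbar)
    (hMbar : gen_sasakian_space_form phi xi eta g f1 f2 f3 nab)
    (M : manifold R m.+1) (iota : M -> Mbar) (hM : is_submanifold iota)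
    (hxi : xi_tangent xi iota)
    (lam : 'I_l -> M -> R) (hlam : almost_semi_invariant phi xi g iota lam)
    (hmin : minimal g xi (semisym eta nab) iota)
    (U : set M) (E : 'I_m.+1 -> vfield M) (hU : open U)
    (hE : adapted_frame g xi iota U E) :
  (forall X : vfield M, smooth_vf U X -> forall p, U p ->
     ricci g (semisym eta nab) iota E X X p
     <= \sum_(a <- lambdas lam p)
          (m%:R * f1 (iota p) + 3 * f2 (iota p) * a ^+ 2 - f3 (iota p) + 1)
          * ind_metric g iota p (Uproj phi xi g iota p a (X p))
                                (Uproj phi xi g iota p a (X p))
        + m%:R * (f1 (iota p) - f3 (iota p))
          * (ind_eta eta iota p (X p) * ind_eta eta iota p (X p))
        + (f1 (iota p) - f3 (iota p))
          * ind_metric g iota p (Tmap phi g iota p (X p)) (X p))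
  /\
  (forall p, U p ->
     scal g (semisym eta nab) iota E p
     <= f1 (iota p)
        + (m * m.+1)%:R^-1
          * (3 * f2 (iota p)
               * (\sum_(a <- lambdas lam p)
                    (\dim (Deig phi xi g iota p a))%:R * a ^+ 2)
             - 2 * m%:R * f3 (iota p) + m%:R)).
Proof.
pose b p := ind_metric g iota p.
have bl p := ind_metric_linear hM (acm_metric (gssf_acm hMbar)) p.
have bs p := ind_metric_sym (acm_metric (gssf_acm hMbar)) (iota := iota) p.
have bp p := @ind_metric_pos _ _ _ _ _ _ hM _ (acm_metric (gssf_acm hMbar)) p.
have skew p (Up : U p) := Tmap_skew hMbar hM hE Up.
have Txi p (Up : U p) := Tmap_xi hMbar hM hxi hE Up.
have xi1 p (Up : U p) := ind_xi1 hMbar hM hxi hE Up.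
have eig p (Up : U p) := mem_Deig hMbar hM hE Up.
have lam01 p i := asi_range hlam i p.
have lam_inj p := asi_distinct hlam p.
have full p := asi_full hlam p.
have norm p (Up : U p) := norm_decomposition (bl p) (bs p) (bp p) (skew p Up) (xi1 p Up)
  (lam01 p) (lam_inj p) (eig p Up) (full p).
have normT p (Up : U p) := norm_skew_image (bl p) (bs p) (bp p) (skew p Up) (Txi p Up)
  (xi1 p Up) (lam01 p) (lam_inj p) (eig p Up) (full p).
split=> [X sX p Up|p Up].
  have le := ricci_le hMbar hM hxi hU hE Up hmin sX.
  have etaX : ind_eta eta iota p (X p) = _ := ind_eta_xi hMbar hM hxi hE Up (X p).
  have TX := Tmap_orth hMbar hM hE Up (X p).
  have N1 := norm p Up (X p); have N2 := normT p Up (X p).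
  apply: le_trans le _; rewrite etaX TX mulr0 addr0.
  set x2 := ind_metric g iota p (X p) (X p) in N1 *.
  set t2 := ind_metric g iota p (Tmap _ _ _ _ _) _ in N2 *.
  set ex := ind_metric g iota p (X p) _ in N1 *.
  have -> : \sum_(a <- lambdas lam p)
      (m%:R * f1 (iota p) + 3 * f2 (iota p) * a ^+ 2 - f3 (iota p) + 1)
          * ind_metric g iota p (Uproj phi xi g iota p a (X p))
                                (Uproj phi xi g iota p a (X p))
      = (m%:R * f1 (iota p) - f3 (iota p) + 1) * (x2 - ex ^+ 2) + 3 * f2 (iota p) * t2.
    rewrite N1 N2 addrK !mulr_sumr -big_split /=; apply: eq_bigr => a _.
    by rewrite /Uproj; ring.
  by rewrite le_eqVlt; apply/orP; left; apply/eqP; ring.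
have onb i j : ind_metric g iota p (E i p) (E j p) = (i == j)%:R.
  exact: (frame_orthonormal hE Up i j).
have le i := ricci_le hMbar hM hxi hU hE Up hmin (frame_smooth hE i).
have He : \sum_i ind_metric g iota p (E i p) (ind_xi g xi iota p)
    * ind_metric g iota p (E i p) (ind_xi g xi iota p) = 1.
  rewrite -[RHS](xi1 p Up) -[RHS](sum_frame hMbar hM hE Up).
  by apply: eq_bigr => i _; rewrite (bs p (E i p)).
have Ht : \sum_i ind_metric g iota p (Tmap phi g iota p (E i p)) (Tmap phi g iota p (E i p))
    = \sum_(a <- lambdas lam p) (\dim (Deig phi xi g iota p a))%:R * a ^+ 2.
  rewrite (eq_bigr _ (fun i _ => normT p Up (E i p))) exchange_big /=.
  apply: eq_big_seq => a sa; rewrite -mulr_sumr mulrC; congr (_ * _).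
  exact: (trace_projection (bl p) (bs p) (bp p) (skew p Up) (xi1 p Up) (lam01 p)
    (lam_inj p) (eig p Up) (full p) sa (orthonormal_expand (bl p) onb)).
have m0 : (m * m.+1)%:R != 0 :> R by rewrite pnatr_eq0 -lt0n muln_gt0 hm.
rewrite -Ht.
have total : \sum_i ricci g (semisym eta nab) iota E (E i) (E i) p
    <= (m * m.+1)%:R * f1 (iota p) + (3 * f2 (iota p)
         * \sum_i ind_metric g iota p (Tmap phi g iota p (E i p)) (Tmap phi g iota p (E i p))
         - 2 * m%:R * f3 (iota p) + m%:R).
  apply: le_trans (ler_sum _ (fun i _ => le i)) _.
  under eq_bigr => i _ do rewrite onb eqxx.
  have sum (t e2 : 'I_m.+1 -> R) (F1 F2 F3 : R) : \sum_i e2 i = 1 ->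
      \sum_i (F1 * (m%:R * 1) + F2 * t i + F3 * ((1 - m%:R) * e2 i - 1) + 1 - e2 i)
      = (m * m.+1)%:R * F1 + (F2 * \sum_i t i - 2 * m%:R * F3 + m%:R).
    move=> e1; rewrite !(big_split, sumrN) /= -!mulr_sumr !(big_split, sumrN) /=.
    by rewrite -!mulr_sumr e1 !sumr_const !card_ord natrM; ring.
  by rewrite (sum _ _ _ _ _ He).
have pos : 0 <= (m * m.+1)%:R^-1 :> R by rewrite invr_ge0 ler0n.
apply: le_trans (ler_wpM2l pos total) _.
by rewrite mulrDr mulrA mulVf // mul1r.
Qed.
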